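(* Let $n$ and $k$ be integers with $1\le k\le\lfloor\frac{n-1}{2}\rfloor$, and let $G$ be a cactus on $n$ vertices with exactly $k$ cycles, all of which are triangles. Then $\rho(G)\le\rho\bigl(S(\lfloor\frac{k}{2}\rfloor,\lceil\frac{k}{2}\rceil;n-2k-1)\bigr)$, with equality if and only if $G\cong S(\lfloor\frac{k}{2}\rfloor,\lceil\frac{k}{2}\rceil;n-2k-1)$.
   Context: A cactus is a connected (simple) graph in which any two cycles have at most one common vertex. For a connected graph $G$, $\rho(G)$ denotes the largest eigenvalue of the distance matrix $D(G)=(d_G(u,v))_{u,v\in V(G)}$, where $d_G$ is the usual graph distance. For integers $p,q,\ell\ge 0$, let $m=p+q+\ell+1$ and let $S(p,q;\ell)$ be the graph obtained from the path $v_1v_2\cdots v_m$ by adding, for each $i\in\{1,\dots,p\}\cup\{m-q,\dots,m-1\}$, a new vertex $w_i$ adjacent to exactly $v_i$ and $v_{i+1}$ (so $S(p,q;\ell)$ is a chain of $p$ triangles joined by a path of length $\ell$ to a chain of $q$ triangles, and has $2(p+q)+\ell+1$ vertices). *)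

(* Defs.v *)
From mathcomp Require Import all_boot all_order all_algebra.
From mathcomp Require Export reals.
Set Implicit Arguments. Unset Strict Implicit. Unset Printing Implicit Defensive.
Import Order.TTheory GRing.Theory Num.Theory.

Definition simple_graph (T : finType) (e : rel T) : Prop :=
  symmetric e /\ irreflexive e.

Definition connected_graph (T : finType) (e : rel T) : Prop :=
  forall x y : T, connect e x y.

(* A cycle of G is given by a cyclic sequence of >= 3 distinct vertices,
   consecutive ones (cyclically) adjacent; as a subgraph it is identified
   with its edge set (edges are 2-element vertex sets). *)
Definition cycle_seq (T : finType) (e : rel T) (s : seq T) : bool :=
  [&& 2 < size s, cycle e s & uniq s].

Definition cyc_edges (T : finType) (s : seq T) : {set {set T}} :=
  [set [set x; next s x] | x in s].

Definition is_cycle (T : finType) (e : rel T) (F : {set {set T}}) : Prop :=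
  exists s : seq T, cycle_seq e s /\ F = cyc_edges s.

Definition cyc_vertices (T : finType) (F : {set {set T}}) : {set T} :=
  \bigcup_(E in F) E.

Definition cactus (T : finType) (e : rel T) : Prop :=
  connected_graph e /\
  forall F1 F2, is_cycle e F1 -> is_cycle e F2 -> F1 <> F2 ->
    #|cyc_vertices F1 :&: cyc_vertices F2| <= 1.

Definition num_cycles_eq (T : finType) (e : rel T) (k : nat) : Prop :=
  exists C : {set {set {set T}}}, #|C| = k /\ forall F, F \in C <-> is_cycle e F.

Definition all_cycles_triangles (T : finType) (e : rel T) : Prop :=
  forall F, is_cycle e F -> #|F| = 3.

(* Graph distance: ball m u = vertices at distance <= m from u;
   dist u v = least m with v in ball m u (meaningful for connected graphs). *)
Definition ball (T : finType) (e : rel T) (u : T) (m : nat) : {set T} :=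
  iter m (fun S => S :|: [set y | [exists x in S, e x y]]) [set u].

Definition dist (T : finType) (e : rel T) (u v : T) : nat :=
  find (fun m => v \in ball e u m) (iota 0 #|T|).

Definition dist_mx (R : realType) (T : finType) (e : rel T) : 'M[R]_#|T| :=
  \matrix_(i, j) ((dist e (enum_val i) (enum_val j))%:R)%R.

Definition largest_eig (R : realType) (n : nat) (A : 'M[R]_n) (r : R) : Prop :=
  eigenvalue A r /\ forall mu : R, eigenvalue A mu -> (mu <= r)%R.

(* The graph S(p,q;l) on vertex set {0,...,2(p+q)+l}: with m = p+q+l+1,
   path vertex v_i is index i-1 (i = 1..m); the j-th extra vertex
   (j < p+q) is index m+j, and corresponds to w_i with
   i = j+1 if j < p and i = m-q+(j-p) otherwise; it is adjacent to
   v_i, v_{i+1}, i.e. indices wbase j, (wbase j)+1. *)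
Definition wbase (p q l j : nat) : nat :=
  if j < p then j else (p + q + l + 1) - q - 1 + (j - p).

Definition w_adj (p q l j y : nat) : bool :=
  (j < p + q) && ((y == wbase p q l j) || (y == (wbase p q l j).+1)).

Definition S_adj (p q l x y : nat) : bool :=
  let m := p + q + l + 1 in
  [|| (x < m) && (y < m) && ((x.+1 == y) || (y.+1 == x)),
      (m <= x) && (y < m) && w_adj p q l (x - m) y
    | (m <= y) && (x < m) && w_adj p q l (y - m) x].

Definition S_rel (p q l : nat) : rel 'I_(2 * (p + q) + l + 1) :=
  fun x y => S_adj p q l x y.

Definition graph_iso (T T' : finType) (e : rel T) (e' : rel T') : Prop :=
  exists f : T -> T', bijective f /\ forall x y, e' (f x) (f y) = e x y.

Arguments S_rel : clear implicits.

(* Main.v *)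
Require Import Defs.
From mathcomp Require Import all_boot all_order all_algebra.
From mathcomp Require Import reals.
From mathcomp Require Import ring lra zify.
From mathcomp Require boolp classical_sets.
Import Order.TTheory GRing.Theory Num.Theory.
Local Open Scope ring_scope.
Set Implicit Arguments. Unset Strict Implicit. Unset Printing Implicit Defensive.

(** All graphs involved have blocks [K_2] and [K_3] only, so the distance form
    [sum_{u,v} d(u,v) x_u x_v] is twice a sum over the blocks of the second
    elementary symmetric function of the total weights hanging at the vertices of
    the block. For positive weights [x], local rearrangements (carrying the labels
    along) turn a cactus into a chain, and then into a chain with all its triangles
    at the two ends, strictly increasing the form unless nothing has to be done; with
    [x] the Perron vector of [G] this gives [rho(G) <= rho(S(p,q;l))] for some
    [p + q = k].

    Comparing [S(p,q;l)] with [S(p+1,q-1;l)] for [p + 2 <= q] depends on the weights.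
    Let [x] be the Perron vector of [S(p,q;l)], let [w0] be the innermost apex on the
    right, let [K] be the vertices other than [w0] which lie in the part symmetric about
    the middle of the linking path, and let [D'] be the matrix obtained by moving [w0]
    to its mirror position. The test vector [x - x_{w0} g], where [g] solves
    [(rho - D_K) g = c] with [c] the change of the row of [w0], raises the form by exactly
    [2 rho x_{w0} g(v_1) X], [X] being the weight outside [K] and [w0]. A discrete
    Sturm argument shows [g(v_1) > 0]. *)

(** Equality is followed through by making each rearrangement a dichotomy: the form grows strictly
    at the given weights, or the two forms agree at all vectors. If the radii are equal, only the
    second case remains; polarization then gives equal distances, and adjacency is distance one.

    Carrying [w0] across with the weights kept changes the form by an amount of no evident sign. The
    vector [g] repairs this: [y = x - x_{w0} g] satisfies the eigen-equation of [D'] at the old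
    [rho] on all of [K], so only [w0] and the vertices outside [K] matter. There [D' y - rho y]
    equals [rho g(v_1) X] at [w0] and, up to multiples of [g] that vanish, [rho x_{w0} g(v_1)] at
    each outer vertex; paired with [y], these give two equal halves, whence the factor 2. The
    reflection changes the sign of [c], hence of [g], and this antisymmetry supplies every
    cancellation. Along a chain, distance is half a difference of positions up to parity terms, so
    the system for [g] becomes a second-order recurrence: that is where Sturm enters. *)

Ltac perm_count := apply/permP => ?; repeat (rewrite ?count_cat /=); clear; lia.

(** * Hanging chains, and the moves that turn stars and triangles with arms into chains *)

Section Arms.
Variables (R : realFieldType) (T : eqType).
Implicit Types (x : T -> R) (A B C : seq (option T * T)) (b : option T * T).

(* A chain hanging at a vertex is a list of blocks going outwards: [(None, v)] is an edge
   to [v], and [(Some y, v)] a triangle through [v] with apex [y]. *)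
Definition oweight x (o : option T) : R := if o is Some y then x y else 0.
Definition bweight x b : R := oweight x b.1 + x b.2.
Definition weight x A : R := \sum_(b <- A) bweight x b.
Definition olabels (o : option T) : seq T := if o is Some y then [:: y] else [::].
Definition blabels b : seq T := olabels b.1 ++ [:: b.2].
Definition labels A : seq T := flatten (map blabels A).
Definition pat A : bitseq := map (fun b => isSome b.1) A.
Definition ntri A : nat := count id (pat A).

(* Contributions of the blocks of a hanging chain, [S] being the total weight of the graph:
   a block whose vertices carry [a], [b], [c] contributes [ab + bc + ca]. *)
Fixpoint cost x (S : R) A : R :=
  if A is (o, v) :: A' then
    oweight x o * (x v + weight x A') + (oweight x o + (x v + weight x A')) * (S - oweight x o - (x v + weight x A'))
      + cost x S A'
  else 0.

(* Half the distance form of the chain made of [z] and of two chains [A], [B] hanging at it;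
   [star3] has three chains hanging at [z], and [tri3] a triangle [v v' w] with one at each vertex. *)
Definition chain_form x z A B : R :=
  let S := x z + weight x A + weight x B in cost x S A + cost x S B.

Definition star3 x z A B C : R :=
  let S := x z + weight x A + weight x B + weight x C in cost x S A + cost x S B + cost x S C.

Definition tri3 x v A v' B w C : R :=
  let a := x v + weight x A in let b := x v' + weight x B in let c := x w + weight x C in
  let S := a + b + c in
  a * b + b * c + c * a + (cost x S A + cost x S B + cost x S C).

Lemma wt_nil x : weight x [::] = 0. Proof. by rewrite /weight big_nil. Qed.
Lemma wt_cons x o v A : weight x ((o, v) :: A) = oweight x o + x v + weight x A.
Proof. by rewrite /weight big_cons. Qed.

Lemma lab_cons o v A : labels ((o, v) :: A) = olabels o ++ v :: labels A.
Proof. by rewrite /labels /= /blabels /= -catA. Qed.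

Lemma wt_lab x A : weight x A = \sum_(u <- labels A) x u.
Proof.
elim: A => [|[o v] A IH]; first by rewrite wt_nil big_nil.
rewrite wt_cons lab_cons big_cat big_cons -IH; case: o => [y|] /=.
  by rewrite big_seq1; ring.
by rewrite big_nil; ring.
Qed.

Lemma cvC x z A B : chain_form x z A B = chain_form x z B A.
Proof. by rewrite /chain_form [_ + weight x B]addrAC [RHS]addrC. Qed.

(** A chain has no preferred base: the block between [z] and [v] is reread as hanging at [v]. *)
Lemma cv_shift x z o v A B : chain_form x z ((o, v) :: A) B = chain_form x v A ((o, z) :: B).
Proof.
rewrite /chain_form !wt_cons /=.
have -> : x v + weight x A + (oweight x o + x z + weight x B) =
  x z + (oweight x o + x v + weight x A) + weight x B by ring.
ring.
Qed.

Lemma ow_ge0 x o : (forall u, 0 < x u) -> 0 <= oweight x o.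
Proof. by move=> xp; case: o => //= y; apply/ltW. Qed.

Lemma wt_ge0 x A : (forall u, 0 < x u) -> 0 <= weight x A.
Proof. by move=> xp; apply: sumr_ge0 => -[o v] _; rewrite addr_ge0 ?ow_ge0 ?ltW. Qed.

Lemma wt_gt0 x A : (forall u, 0 < x u) -> A != [::] -> 0 < weight x A.
Proof.
case: A => // -[o v] A xp _; rewrite wt_cons.
by have := wt_ge0 A xp; have := ow_ge0 o xp; have := xp v; lra.
Qed.

Lemma eq_ow x x' o : {in olabels o, x =1 x'} -> oweight x o = oweight x' o.
Proof. by case: o => //= y h; apply: h; rewrite inE. Qed.

Lemma eq_wt x x' A : {in labels A, x =1 x'} -> weight x A = weight x' A.
Proof. by move=> h; rewrite !wt_lab; apply: eq_big_seq. Qed.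

Lemma eq_cost x x' S A : {in labels A, x =1 x'} -> cost x S A = cost x' S A.
Proof.
elim: A => [|[o v] A IH] //=; rewrite lab_cons => h.
have hA : {in labels A, x =1 x'}.
  by move=> u uA; apply: h; rewrite mem_cat inE uA !orbT.
rewrite (IH hA) (eq_wt hA) (@eq_ow x x') ?h ?mem_cat ?inE ?eqxx ?orbT //.
by move=> u uo; apply: h; rewrite mem_cat uo.
Qed.

(** Only the attaching point of [C] moves, across one block: [C] gets one farther from [z] and [B],
    one nearer to [v] and [A], and stays equally far from the apex. *)
Lemma star3_step x z o v A B C :
  star3 x v A ((o, z) :: B) C - star3 x z ((o, v) :: A) B C =
  weight x C * (x z + weight x B - x v - weight x A).
Proof.
rewrite /star3 !wt_cons /=.
have -> : x v + weight x A + (oweight x o + x z + weight x B) + weight x C =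
  x z + (oweight x o + x v + weight x A) + weight x B + weight x C by ring.
ring.
Qed.

(** Along [p], [v], [w], the apex [o] and the vertex [v'] with its arm [B] exchange blocks: [v'] and
    [B] get one nearer to [p] and [A] and one farther from [w] and [C], [o] the opposite. *)
Lemma tri3_step x v o p A v' B w C :
  tri3 x p A v' B v ((o, w) :: C) - tri3 x v ((o, p) :: A) v' B w C =
  (x w + weight x C - x p - weight x A) * (x v' + weight x B - oweight x o).
Proof.
rewrite /tri3 !wt_cons /=.
have -> : x p + weight x A + (x v' + weight x B) + (x v + (oweight x o + x w + weight x C)) =
  x v + (oweight x o + x p + weight x A) + (x v' + weight x B) + (x w + weight x C) by ring.
ring.
Qed.

Lemma star3_nil x z B C : star3 x z [::] B C = chain_form x z B C.
Proof. by rewrite /star3 /chain_form wt_nil addr0 /= add0r. Qed.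

Lemma star3CA x z A B C : star3 x z A B C = star3 x z B A C.
Proof. by rewrite /star3 [x z + weight x A + _]addrAC [cost _ _ A + _]addrC. Qed.

Lemma tri3_nil x v v' B w C : tri3 x v [::] v' B w C = chain_form x w C ((Some v, v') :: B).
Proof.
rewrite /tri3 /chain_form !wt_cons wt_nil /=.
have -> : x w + weight x C + (x v + x v' + weight x B) =
  x v + 0 + (x v' + weight x B) + (x w + weight x C) by ring.
ring.
Qed.

Lemma tri3_rot x v A v' B w C : tri3 x v A v' B w C = tri3 x v' B w C v A.
Proof.
rewrite /tri3.
have -> : x v' + weight x B + (x w + weight x C) + (x v + weight x A) =
  x v + weight x A + (x v' + weight x B) + (x w + weight x C) by ring.
ring.
Qed.

Lemma tri3_swap x v A v' B w C : tri3 x v A v' B w C = tri3 x v' B v A w C.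
Proof.
rewrite /tri3.
have -> : x v' + weight x B + (x v + weight x A) + (x w + weight x C) =
  x v + weight x A + (x v' + weight x B) + (x w + weight x C) by ring.
ring.
Qed.

Definition chain_vts z A B : seq T := z :: labels A ++ labels B.

(** [C] slides out along the lighter arm [A]. Each step shortens [A] and lengthens [B], so the
    comparison persists; at the end of [A] only two arms are left. *)
Lemma star3_chain_le x z A B C : (forall u, 0 < x u) -> weight x A <= weight x B ->
  exists z' A' B', [/\ perm_eq (chain_vts z' A' B') (z :: labels A ++ labels B ++ labels C),
    (ntri A' + ntri B' = ntri A + ntri B + ntri C)%N &
    star3 x z A B C <= chain_form x z' A' B'].
Proof.
move=> xp; elim: A z B => [|[o v] A IH] z B.
  by move=> _; exists z, B, C; split=> //; rewrite star3_nil.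
rewrite wt_cons => le_ab.
have yp := ow_ge0 o xp; have vp := xp v; have zp := xp z.
have [|z' [A' [B' [pe nt le]]]] := IH v ((o, z) :: B); first by rewrite wt_cons; lra.
exists z', A', B'; split.
- apply: (perm_trans pe); rewrite !lab_cons.
  by perm_count.
- by rewrite nt /ntri /=; clear; lia.
apply: le_trans le; rewrite -subr_ge0 star3_step.
by apply: mulr_ge0; [exact: wt_ge0 | lra].
Qed.

(** The arms are compared without [z], whose positive weight makes the first step strict; the later
    ones lose nothing. *)
Lemma star3_chain_lt x z A B C : (forall u, 0 < x u) ->
  A != [::] -> B != [::] -> C != [::] ->
  exists z' A' B', [/\ perm_eq (chain_vts z' A' B') (z :: labels A ++ labels B ++ labels C),
    (ntri A' + ntri B' = ntri A + ntri B + ntri C)%N &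
    star3 x z A B C < chain_form x z' A' B'].
Proof.
move=> xp; wlog le_ab : A B / weight x A <= weight x B.
  move=> H A0 B0 C0; case: (lerP (weight x A) (weight x B)) => [/H|/ltW/H]; first exact.
  case=> // z' [A' [B' [pe nt lt]]]; exists z', A', B'; split.
  - by apply: (perm_trans pe); rewrite perm_cons perm_catCA.
  - by rewrite nt [(ntri B + _)%N]addnC.
  - by rewrite star3CA.
case: A le_ab => // -[o v] A le_ab _ B0 C0.
have le_ab' : weight x A <= weight x ((o, z) :: B).
  have yp := ow_ge0 o xp; have vp := xp v; have zp := xp z.
  by move: le_ab; rewrite !wt_cons; lra.
have [z' [A' [B' [pe nt le]]]] := star3_chain_le v C xp le_ab'.
exists z', A', B'; split.
- apply: (perm_trans pe); rewrite !lab_cons.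
  by perm_count.
- by rewrite nt /ntri /=; clear; lia.
apply: lt_le_trans le; rewrite -subr_gt0 star3_step.
apply: mulr_gt0; first exact: wt_gt0.
have yp := ow_ge0 o xp; have zp := xp z.
by move: le_ab; rewrite !wt_cons; lra.
Qed.

(** The triangle slides out along the arm at its lightest corner; both factors of the gain are
    positive at each step. When the arm is used up, the bare corner is the apex of a triangle of a
    chain. *)
Lemma tri3_chain_le x v A v' B w C : (forall u, 0 < x u) ->
  x v + weight x A <= x v' + weight x B -> x v + weight x A <= x w + weight x C ->
  exists z' A' B', [/\ perm_eq (chain_vts z' A' B') (v :: labels A ++ (v' :: labels B) ++ w :: labels C),
    (ntri A' + ntri B' = (ntri A + ntri B + ntri C).+1)%N &
    if A == [::] then tri3 x v A v' B w C <= chain_form x z' A' B' 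
    else tri3 x v A v' B w C < chain_form x z' A' B'].
Proof.
move=> xp; elim: A v w C => [|[o p] A IH] v w C.
  move=> _ _; exists w, C, ((Some v, v') :: B); split.
  - rewrite /chain_vts lab_cons.
    by perm_count.
  - by rewrite /ntri /=; lia.
  - by rewrite eqxx tri3_nil.
rewrite wt_cons => le_ab le_ac.
have yp := ow_ge0 o xp; have vp := xp v; have pp := xp p; have wp := xp w.
have cp := wt_ge0 C xp; have ap := wt_ge0 A xp.
have [||z' [A' [B' [pe nt le]]]] := IH p v ((o, w) :: C).
- by lra.
- by rewrite wt_cons; lra.
exists z', A', B'; split.
- apply: (perm_trans pe); rewrite !lab_cons.
  by perm_count.
- by rewrite nt /ntri /=; clear; lia.
have {}le : tri3 x p A v' B v ((o, w) :: C) <= chain_form x z' A' B'.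
  by case: eqP le => // _ /ltW.
apply: lt_le_trans le; rewrite -subr_gt0 tri3_step.
by apply: mulr_gt0; lra.
Qed.

Lemma tri3_chain_lt x v A v' B w C : (forall u, 0 < x u) ->
  A != [::] -> B != [::] -> C != [::] ->
  exists z' A' B', [/\ perm_eq (chain_vts z' A' B') (v :: labels A ++ (v' :: labels B) ++ w :: labels C),
    (ntri A' + ntri B' = (ntri A + ntri B + ntri C).+1)%N &
    tri3 x v A v' B w C < chain_form x z' A' B'].
Proof.
move=> xp A0 B0 C0.
have main v1 A1 v2 A2 v3 A3 : A1 != [::] ->
    x v1 + weight x A1 <= x v2 + weight x A2 -> x v1 + weight x A1 <= x v3 + weight x A3 ->
    perm_eq (v1 :: labels A1 ++ (v2 :: labels A2) ++ v3 :: labels A3)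
            (v :: labels A ++ (v' :: labels B) ++ w :: labels C) ->
    (ntri A1 + ntri A2 + ntri A3 = ntri A + ntri B + ntri C)%N ->
    tri3 x v A v' B w C = tri3 x v1 A1 v2 A2 v3 A3 ->
    exists z' A' B', [/\ perm_eq (chain_vts z' A' B') (v :: labels A ++ (v' :: labels B) ++ w :: labels C),
    (ntri A' + ntri B' = (ntri A + ntri B + ntri C).+1)%N &
    tri3 x v A v' B w C < chain_form x z' A' B'].
  move=> A10 le12 le13 pe nt ->.
  have [z' [A' [B' [pe' nt']]]] := tri3_chain_le xp le12 le13.
  rewrite (negPf A10) => lt; exists z', A', B'; split=> //.
    exact: perm_trans pe' pe.
  by rewrite nt' nt.
have permtac (s1 s2 s3 : seq T) :
    [/\ perm_eq (v' :: s2 ++ (w :: s3) ++ v :: s1) (v :: s1 ++ (v' :: s2) ++ w :: s3)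
      & perm_eq (w :: s3 ++ (v :: s1) ++ v' :: s2) (v :: s1 ++ (v' :: s2) ++ w :: s3)].
  by split; perm_count.
have [pe1 pe2] := permtac (labels A) (labels B) (labels C).
have nt1 : (ntri B + ntri C + ntri A = ntri A + ntri B + ntri C)%N by lia.
have nt2 : (ntri C + ntri A + ntri B = ntri A + ntri B + ntri C)%N by lia.
have e1 := tri3_rot x v A v' B w C.
have e2 : tri3 x v A v' B w C = tri3 x w C v A v' B by rewrite -tri3_rot.
case: (lerP (x v + weight x A) (x v' + weight x B)) => hab.
  case: (lerP (x v + weight x A) (x w + weight x C)) => hac; first exact: (main v A v' B w C).
  by apply: (main w C v A v' B) => //; lra.
case: (lerP (x v' + weight x B) (x w + weight x C)) => hbc.
  by apply: (main v' B w C v A) => //; lra.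
by apply: (main w C v A v' B) => //; lra.
Qed.

(** With [c] the weight of a piece hanging at [u], this collapses the piece onto [u]; later it also
    perturbs single coordinates of test vectors. *)
Definition bump x (u : T) (c : R) : T -> R := fun t => if t == u then x t + c else x t.

(** Prepares an attachment at [u]: a path vertex becomes the base, with two arms; for an apex, its
    triangle is brought next to the base, so that the other two corners carry the arms. *)
Lemma focus z A B u : u \in chain_vts z A B ->
  (exists A1 B1, [/\ perm_eq (chain_vts u A1 B1) (chain_vts z A B),
     (ntri A1 + ntri B1 = ntri A + ntri B)%N & forall y, chain_form y z A B = chain_form y u A1 B1]) \/
  (exists v A1 v' B1, [/\ perm_eq (chain_vts v ((Some u, v') :: A1) B1) (chain_vts z A B),
     ((ntri A1 + ntri B1).+1 = ntri A + ntri B)%N &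
     forall y, chain_form y z A B = chain_form y v ((Some u, v') :: A1) B1]).
Proof.
have arm A0 z0 B0 : u \in labels A0 ->
  (exists A1 B1, [/\ perm_eq (chain_vts u A1 B1) (chain_vts z0 A0 B0),
     (ntri A1 + ntri B1 = ntri A0 + ntri B0)%N & forall y, chain_form y z0 A0 B0 = chain_form y u A1 B1]) \/
  (exists v A1 v' B1, [/\ perm_eq (chain_vts v ((Some u, v') :: A1) B1) (chain_vts z0 A0 B0),
     ((ntri A1 + ntri B1).+1 = ntri A0 + ntri B0)%N &
     forall y, chain_form y z0 A0 B0 = chain_form y v ((Some u, v') :: A1) B1]).
  elim: A0 z0 B0 => [|[o v] A0 IH] z0 B0 //.
  rewrite lab_cons mem_cat inE orbCA => /or3P[/eqP uv|uo|uA]; first last.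
  - have pe : perm_eq (chain_vts v A0 ((o, z0) :: B0)) (chain_vts z0 ((o, v) :: A0) B0).
      rewrite /chain_vts !lab_cons.
      by perm_count.
    have nt : (ntri A0 + ntri ((o, z0) :: B0) = ntri ((o, v) :: A0) + ntri B0)%N.
      by rewrite /ntri /=; lia.
    case: (IH v ((o, z0) :: B0) uA) => [[A1 [B1 [h1 h2 h3]]]|[v1 [A1 [v' [B1 [h1 h2 h3]]]]]].
      left; exists A1, B1; split; [exact: perm_trans h1 pe | by rewrite h2 |].
      by move=> y; rewrite cv_shift h3.
    right; exists v1, A1, v', B1; split; [exact: perm_trans h1 pe | by rewrite h2 |].
    by move=> y; rewrite cv_shift h3.
  - case: o uo => // y; rewrite inE => /eqP uy; right.
    by exists z0, A0, v, B0; rewrite -uy; split.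
  - left; exists A0, ((o, z0) :: B0); rewrite uv; split.
    + rewrite /chain_vts !lab_cons.
      by perm_count.
    + by rewrite /ntri /=; lia.
    + by move=> y; rewrite cv_shift.
rewrite inE mem_cat => /or3P[/eqP->|uA|uB].
- by left; exists A, B.
- exact: arm.
- have pe : perm_eq (chain_vts z B A) (chain_vts z A B) by rewrite perm_cons perm_catC.
  case: (arm B z A uB) => [[A1 [B1 [h1 h2 h3]]]|[v1 [A1 [v' [B1 [h1 h2 h3]]]]]].
    left; exists A1, B1; split; [exact: perm_trans h1 pe | by rewrite h2 addnC |].
    by move=> y; rewrite cvC h3.
  right; exists v1, A1, v', B1; split; [exact: perm_trans h1 pe | by rewrite h2 addnC |].
  by move=> y; rewrite cvC h3.
Qed.

End Arms.

(** * Attaching one block to a chain, and sorting a chain outwards from a centroid *)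

Section Arms2.
Variables (R : realFieldType) (T : eqType).
Implicit Types (x : T -> R) (A B C : seq (option T * T)) (b : option T * T).

Definition total x z A B : R := x z + weight x A + weight x B.

Lemma ntri_nil : ntri ([::] : seq (option T * T)) = 0%N. Proof. by []. Qed.

Lemma total_perm x z A B z' A' B' : perm_eq (chain_vts z A B) (chain_vts z' A' B') ->
  total x z A B = total x z' A' B'.
Proof.
have h z1 A1 B1 : total x z1 A1 B1 = \sum_(u <- chain_vts z1 A1 B1) x u.
  by rewrite /chain_vts big_cons big_cat /= -!wt_lab addrA.
by move=> pe; rewrite !h; apply: perm_big.
Qed.

Lemma bump_out x u c t : t != u -> bump x u c t = x t.
Proof. by rewrite /bump => /negPf->. Qed.

Lemma bump_in x u c : bump x u c u = x u + c.
Proof. by rewrite /bump eqxx. Qed.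

Lemma wt_bump x u c A : u \notin labels A -> weight (bump x u c) A = weight x A.
Proof.
by move=> uA; apply: eq_wt => t tA; apply: bump_out; apply: contraNneq uA => <-.
Qed.

Lemma cost_bump x u c S A : u \notin labels A -> cost (bump x u c) S A = cost x S A.
Proof.
by move=> uA; apply: eq_cost => t tA; apply: bump_out; apply: contraNneq uA => <-.
Qed.

(** Collapsing [C] onto [u] changes neither the total weight nor the weight beyond any block of [A]
    and [B]. *)
Lemma attach_star x u A B C : u \notin labels A ++ labels B ->
  chain_form (bump x u (weight x C)) u A B + cost x (total x u A B + weight x C) C = star3 x u A B C.
Proof.
rewrite mem_cat negb_or => /andP[uA uB].
rewrite /chain_form /star3 /total !wt_bump // bump_in !cost_bump //.
set S := x u + _ + _ + weight x C.
by have -> : x u + weight x C + weight x A + weight x B = S by rewrite /S; ring.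
Qed.

Lemma attach_tri x u v A v' B C : uniq (chain_vts v ((Some u, v') :: A) B) ->
  chain_form (bump x u (weight x C)) v ((Some u, v') :: A) B +
  cost x (total x v ((Some u, v') :: A) B + weight x C) C = tri3 x v B v' A u C.
Proof.
rewrite /chain_vts lab_cons /= !inE !negb_or -!andbA => /and5P[vu vv' _ uv' /andP[]].
rewrite mem_cat negb_or => /andP[uA uB] _.
rewrite /chain_form /tri3 /total /= wt_cons /= !wt_cons /= !wt_bump // bump_in !bump_out ?(eq_sym v' u) //.
rewrite !cost_bump //.
set S := x v + weight x B + (x v' + weight x A) + (x u + weight x C).
have -> : x v + (x u + weight x C + x v' + weight x A) + weight x B = S by rewrite /S; ring.
have -> : x v + (x u + x v' + weight x A) + weight x B + weight x C = S by rewrite /S; ring.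
rewrite /S; ring.
Qed.

(** If an arm at the attaching place is missing, the result is already a chain and the identity
    holds for all [y]; otherwise three arms are present and a strict move applies. *)
Lemma attach_block x z A B u blk : (forall t, 0 < x t) ->
  uniq (chain_vts z A B) -> u \in chain_vts z A B ->
  let C := [:: blk] in
  exists z' A' B', [/\ perm_eq (chain_vts z' A' B') (blabels blk ++ chain_vts z A B),
    (ntri A' + ntri B' = isSome blk.1 + (ntri A + ntri B))%N &
    (chain_form (bump x u (weight x C)) z A B + cost x (total x z A B + weight x C) C < chain_form x z' A' B') \/
    (forall y, chain_form (bump y u (weight y C)) z A B + cost y (total y z A B + weight y C) C = chain_form y z' A' B')].
Proof.
move=> xp un uin C.
have labC : labels C = blabels blk by rewrite /labels /= cats0.
have nC : ntri C = isSome blk.1 by rewrite /ntri /= addn0.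
case: (focus R uin) => [[A1 [B1 [pe nt cvE]]]|[v [A1 [v' [B1 [pe nt cvE]]]]]].
- have uAB : u \notin labels A1 ++ labels B1.
    by move: un; rewrite -(perm_uniq pe) /= => /andP[].
  have E y : chain_form (bump y u (weight y C)) z A B + cost y (total y z A B + weight y C) C =
             star3 y u A1 B1 C.
    by rewrite cvE -(total_perm y pe) attach_star.
  have pe' : perm_eq (u :: labels A1 ++ labels B1 ++ labels C) (blabels blk ++ chain_vts z A B).
    rewrite labC; apply: (@perm_trans _ (blabels blk ++ chain_vts u A1 B1)); last by rewrite perm_cat2l.
    by rewrite /chain_vts; perm_count.
  case: (altP (A1 =P [::])) => [A10|A10].
    exists u, B1, C; split; first by apply: perm_trans pe'; rewrite A10 /chain_vts ?lab_cons; perm_count.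
      by rewrite nC -nt A10 ntri_nil; lia.
    by right=> y; rewrite E A10 star3_nil.
  case: (altP (B1 =P [::])) => [B10|B10].
    exists u, A1, C; split; first by apply: perm_trans pe'; rewrite B10 /chain_vts ?lab_cons; perm_count.
      by rewrite nC -nt B10 ntri_nil; lia.
    by right=> y; rewrite E B10 star3CA star3_nil.
  have [//|z' [A' [B' [h1 h2 h3]]]] := star3_chain_lt u xp A10 B10 (C := C) _.
  exists z', A', B'; split; first exact: perm_trans h1 pe'.
    by rewrite h2 nC -nt; clear; lia.
  by left; rewrite E.
- have un' : uniq (chain_vts v ((Some u, v') :: A1) B1) by rewrite (perm_uniq pe).
  have E y : chain_form (bump y u (weight y C)) z A B + cost y (total y z A B + weight y C) C =
             tri3 y v B1 v' A1 u C.
    by rewrite cvE -(total_perm y pe) attach_tri.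
  have pe' : perm_eq (v :: labels B1 ++ (v' :: labels A1) ++ u :: labels C) (blabels blk ++ chain_vts z A B).
    rewrite labC.
    apply: (@perm_trans _ (blabels blk ++ chain_vts v ((Some u, v') :: A1) B1)); last by rewrite perm_cat2l.
    by rewrite /chain_vts lab_cons; perm_count.
  case: (altP (B1 =P [::])) => [B10|B10].
    exists u, C, ((Some v, v') :: A1); split.
    + by apply: perm_trans pe'; rewrite B10 /chain_vts ?lab_cons; perm_count.
    + by rewrite -nt nC B10 /ntri /=; lia.
    + by right=> y; rewrite E B10 tri3_nil.
  case: (altP (A1 =P [::])) => [A10|A10].
    exists u, C, ((Some v', v) :: B1); split.
    + by apply: perm_trans pe'; rewrite A10 /chain_vts ?lab_cons; perm_count.
    + by rewrite -nt nC A10 /ntri /=; lia.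
    + by right=> y; rewrite E A10 tri3_swap tri3_nil.
  have [//|z' [A' [B' [h1 h2 h3]]]] := tri3_chain_lt v v' u xp B10 A10 (C := C) _.
  exists z', A', B'; split; first exact: perm_trans h1 pe'.
    by rewrite h2 nC -nt; clear; lia.
  by left; rewrite E.
Qed.

(** A block sees what lies beyond it only through the total weight there. *)
Lemma cost_tail x S b A A' : weight x A' = weight x A ->
  cost x S (b :: A') = cost x S (b :: A) - cost x S A + cost x S A'.
Proof. by case: b => o v E; rewrite /= E; ring. Qed.

(* What lies beyond the first block of [A] is lighter than what lies before that block. *)
Definition heavy_inside x S A : Prop :=
  if A is b :: A1 then 2 * weight x A1 + bweight x b < S else True.

Lemma kcond_behead x S b A : (forall t, 0 < x t) -> heavy_inside x S (b :: A) -> heavy_inside x S A.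
Proof.
move=> xp; case: A => //= -[o v] A.
rewrite wt_cons /bweight /= => h; apply: le_lt_trans h.
have := wt_ge0 A xp; have := ow_ge0 o xp; have := xp v; have := ow_ge0 b.1 xp; have := xp b.2.
lra.
Qed.

(** Exchanging a triangle with the edge just outside it moves only the apex [y]: one farther from
    the root side, one nearer to what lies beyond [p]. [heavy_inside] says exactly that this is a
    gain, and it persists after the exchange. *)
Lemma insert_tri x S y p A i r : (forall t, 0 < x t) ->
  pat A = nseq i false ++ nseq r true -> heavy_inside x S ((Some y, p) :: A) ->
  exists A', [/\ pat A' = nseq i false ++ nseq r.+1 true,
    perm_eq (labels A') (labels ((Some y, p) :: A)) &
    cost x S ((Some y, p) :: A) < cost x S A' \/ A' = (Some y, p) :: A].
Proof.
move=> xp; elim: i p A => [|i IH] p A.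
  by move=> pA _; exists ((Some y, p) :: A); split; [rewrite /= pA| |right].
case: A => [|[[//|] q] A] //= [pA]; rewrite /bweight wt_cons /= => k.
have yp := xp y; have pp := xp p; have qp := xp q; have ap := wt_ge0 A xp.
have k' : heavy_inside x S ((Some y, q) :: A) by rewrite /heavy_inside /bweight /=; lra.
have [A' [h1 h2 h3]] := IH q A pA k'.
exists ((None, p) :: A'); split; first by rewrite /= h1.
  apply: (@perm_trans _ (p :: labels ((Some y, q) :: A))); first by rewrite lab_cons /= perm_cons.
  by rewrite !lab_cons; perm_count.
left; apply: (@lt_le_trans _ _ (cost x S ((None, p) :: (Some y, q) :: A))).
  rewrite -subr_gt0 /= !wt_cons /=.
  rewrite (_ : _ - _ = x y * (S - x y - x p - (x q + weight x A) - (x q + weight x A))); last by ring.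
  by apply: mulr_gt0 => //; lra.
have wE : weight x A' = weight x ((Some y, q) :: A) by rewrite !wt_lab; apply: perm_big.
rewrite (cost_tail S (None, p) wE).
have : cost x S ((Some y, q) :: A) <= cost x S A'.
  by case: h3 => [/ltW //|->].
by lra.
Qed.

Lemma sort_arm x S A : (forall t, 0 < x t) -> heavy_inside x S A ->
  exists A' i, [/\ pat A' = nseq i false ++ nseq (ntri A) true,
    perm_eq (labels A') (labels A) & cost x S A < cost x S A' \/ A' = A].
Proof.
move=> xp; elim: A => [|[o p] A IH] k; first by exists [::], 0%N; split=> //; right.
have [A' [i [h1 h2 h3]]] := IH (kcond_behead xp k).
have wE : weight x A' = weight x A by rewrite !wt_lab; apply: perm_big.
have cE : cost x S ((o, p) :: A') = cost x S ((o, p) :: A) - cost x S A + cost x S A'.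
  exact: cost_tail.
case: o k cE => [y|] k cE; last first.
  exists ((None, p) :: A'), i.+1; split; first by rewrite /= h1.
    by rewrite !lab_cons perm_cons.
  case: h3 => [lt|->]; last by right.
  by left; rewrite cE; lra.
have k' : heavy_inside x S ((Some y, p) :: A') by move: k; rewrite /heavy_inside wE.
have [A2 [g1 g2 g3]] := insert_tri xp h1 k'.
exists A2, i; split=> //.
  by apply: (perm_trans g2); rewrite !lab_cons /= !perm_cons.
case: h3 => [lt|A'E].
  left; apply: (@lt_le_trans _ _ (cost x S ((Some y, p) :: A'))); first by rewrite cE; lra.
  by case: g3 => [/ltW //|->].
by rewrite -A'E.
Qed.

(* A weighted centroid; when it falls inside a triangle, one of the two path vertices
   of that triangle still satisfies the conditions. *)
Lemma chain_root x z B : (forall t, 0 < x t) ->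
  exists z' A' B', [/\ perm_eq (chain_vts z' A' B') (chain_vts z [::] B),
    (ntri A' + ntri B' = ntri B)%N, forall y : T -> R, chain_form y z [::] B = chain_form y z' A' B',
    heavy_inside x (total x z' A' B') A' & heavy_inside x (total x z' A' B') B'].
Proof.
move=> xp.
have main A0 z0 : heavy_inside x (total x z0 A0 B) A0 ->
  exists z' A' B', [/\ perm_eq (chain_vts z' A' B') (chain_vts z0 A0 B),
    (ntri A' + ntri B' = ntri A0 + ntri B)%N, forall y : T -> R, chain_form y z0 A0 B = chain_form y z' A' B',
    heavy_inside x (total x z' A' B') A' & heavy_inside x (total x z' A' B') B'].
  elim: B A0 z0 => [|[o v] B IH] A0 z0 kA; first by exists z0, A0, [::].
  case: (ltrP (2 * weight x B + bweight x (o, v)) (total x z0 A0 ((o, v) :: B))) => kB.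
    by exists z0, A0, ((o, v) :: B).
  have pe : perm_eq (chain_vts v ((o, z0) :: A0) B) (chain_vts z0 A0 ((o, v) :: B)).
    by rewrite /chain_vts !lab_cons; perm_count.
  have yp := ow_ge0 o xp; have zp := xp z0; have vp := xp v.
  have [|z' [A' [B' [h1 h2 h3 h4 h5]]]] := IH ((o, z0) :: A0) v.
    rewrite (total_perm x pe) /heavy_inside.
    by move: kB; rewrite /total /bweight !wt_cons /=; lra.
  exists z', A', B'; split=> //; first exact: perm_trans h1 pe.
    by rewrite h2 /ntri /=; lia.
  by move=> y; rewrite cvC cv_shift cvC h3.
have [//|z' [A' [B' [h1 h2 h3 h4 h5]]]] := main [::] z.
by exists z', A', B'.
Qed.

Lemma chain_unzip z A B : exists z' B', [/\ pat B' = rev (pat A) ++ pat B,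
  perm_eq (z' :: labels B') (chain_vts z A B) & forall x : T -> R, chain_form x z A B = chain_form x z' [::] B'].
Proof.
elim: A z B => [|[o v] A IH] z B; first by exists z, B.
have [z' [B' [h1 h2 h3]]] := IH v ((o, z) :: B).
exists z', B'; split.
- by rewrite h1 /= rev_cons cat_rcons.
- by apply: (perm_trans h2); rewrite /chain_vts !lab_cons; perm_count.
- by move=> x; rewrite cv_shift h3.
Qed.

(** Both arms at a weighted centroid are sorted with their triangles outermost; read from one end,
    the chain then has one run of triangles at each end. *)
Lemma chain_sorted x z A B : (forall t, 0 < x t) ->
  exists z' B' p l q, [/\ pat B' = nseq p true ++ nseq l false ++ nseq q true,
    perm_eq (z' :: labels B') (chain_vts z A B), (p + q = ntri A + ntri B)%N &
    chain_form x z A B < chain_form x z' [::] B' \/ forall y : T -> R, chain_form y z A B = chain_form y z' [::] B'].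
Proof.
move=> xp.
have [z0 [B0 [p0 pe0 cv0]]] := chain_unzip z A B.
have n0 : ntri B0 = (ntri A + ntri B)%N by rewrite /ntri p0 count_cat count_rev.
have [z1 [A1 [B1 [pe1 n1 cv1 kA kB]]]] := chain_root z0 B0 xp.
have [A2 [i [pA2 peA2 cA]]] := sort_arm xp kA.
have [B2 [j [pB2 peB2 cB]]] := sort_arm xp kB.
have [z3 [B3 [p3 pe3 cv3]]] := chain_unzip z1 A2 B2.
exists z3, B3, (ntri A1), (i + j)%N, (ntri B1); split.
- rewrite p3 pA2 pB2 rev_cat.
  have rv n (c : bool) : rev (nseq n c) = nseq n c.
    by apply: (@eq_from_nth _ c); rewrite ?size_rev // => k; rewrite size_nseq => kn;
       rewrite nth_rev ?size_nseq // !nth_nseq; case: ifP; case: ifP.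
  by rewrite !rv nseqD !catA.
- apply: (perm_trans pe3); apply: (perm_trans _ pe0); apply: (perm_trans _ pe1).
  by rewrite /chain_vts perm_cons perm_cat.
- by rewrite n1.
- have w2 C C' : perm_eq (labels C') (labels C) -> weight x C' = weight x C.
    by move=> pe; rewrite !wt_lab; apply: perm_big.
  have sub (y : T -> R) : chain_form y z A B = chain_form y z1 A1 B1 by rewrite cv0 cv1.
  case: cA cB => [cA|eA] [cB|eB]; [left|left|left|by right=> y; rewrite sub -cv3 eA eB];
    rewrite sub -cv3 /chain_form !(w2 _ _ peA2) !(w2 _ _ peB2).
  + exact: ltrD.
  + by rewrite eB ltrD2r.
  + by rewrite eA ltrD2l.
Qed.

End Arms2.

(** * Distance forms, and the effect of attaching a block *)

Section Forms.
Variables (R : realFieldType) (T : eqType).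
Implicit Types (x : T -> R) (d : T -> T -> R) (s : seq T).

Definition qform d s x : R := \sum_(u <- s) \sum_(v <- s) d u v * x u * x v.

Lemma sum_bump (f : T -> R) s x u c : uniq s -> u \in s ->
  \sum_(t <- s) f t * bump x u c t = \sum_(t <- s) f t * x t + f u * c.
Proof.
move=> us uin; rewrite !(big_rem u uin) /= bump_in mulrDr -!addrA; congr (_ + _).
rewrite [RHS]addrC; congr (_ + _); apply: eq_big_seq => t.
by rewrite mem_rem_uniq // inE => /andP[tu _]; rewrite bump_out.
Qed.

Lemma qform_bump d s x u c : uniq s -> u \in s -> (forall v w, d v w = d w v) -> d u u = 0 ->
  qform d s (bump x u c) = qform d s x + 2 * c * \sum_(z <- s) d u z * x z.
Proof.
move=> us uin dsym d0.
have -> : qform d s (bump x u c) =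
    \sum_(t <- s) (\sum_(v <- s) d t v * x v + d t u * c) * bump x u c t.
  apply: eq_bigr => t _; rewrite -(sum_bump (d t)) // mulr_suml.
  by apply: eq_bigr => v _; ring.
rewrite sum_bump // d0.
have -> : \sum_(t <- s) (\sum_(v <- s) d t v * x v + d t u * c) * x t =
   qform d s x + c * \sum_(z <- s) d u z * x z.
  rewrite /qform mulr_sumr -big_split /=; apply: eq_bigr => t _.
  rewrite mulrDl mulr_suml (dsym u t); congr (_ + _); last by ring.
  by apply: eq_bigr => v _; ring.
by ring.
Qed.

Lemma qform_cons d b s x : (forall v w, d v w = d w v) -> d b b = 0 ->
  qform d (b :: s) x = qform d s x + 2 * x b * \sum_(z <- s) d b z * x z.
Proof.
move=> dsym d0; rewrite /qform big_cons big_cons d0.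
have -> : \sum_(u <- s) \sum_(v <- b :: s) d u v * x u * x v =
  qform d s x + x b * \sum_(z <- s) d b z * x z.
  rewrite mulr_sumr -big_split /=; apply: eq_bigr => t _; rewrite big_cons (dsym t b).
  by rewrite addrC; congr (_ + _); ring.
have -> : \sum_(v <- s) d b v * x b * x v = x b * \sum_(v <- s) d b v * x v.
  by rewrite mulr_sumr; apply: eq_bigr => v _; ring.
by rewrite /qform; ring.
Qed.

Lemma eq_qform d s x x' : {in s, x =1 x'} -> qform d s x = qform d s x'.
Proof.
move=> E; apply: eq_big_seq => u us; apply: eq_big_seq => v vs.
by rewrite !E.
Qed.

Lemma perm_qform d s s' x : perm_eq s s' -> qform d s x = qform d s' x.
Proof.
by move=> pe; rewrite /qform (perm_big _ pe); apply: eq_bigr => u _; apply: perm_big.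
Qed.

(** The vertex [u] is the gate to the new block. In [d u z + 1], the terms [d u z] amount to putting
    the weight of the block on [u]; the ones, with the distance inside the block, make up its
    [cost]. *)
Lemma qform_attach d s x u blk : uniq s -> u \in s ->
  (forall v w, d v w = d w v) -> (forall v, d v v = 0) ->
  (forall b z, b \in blabels blk -> z \in s -> d b z = d u z + 1) ->
  (forall c, blk.1 = Some c -> d c blk.2 = 1) ->
  qform d (blabels blk ++ s) x =
  qform d s (bump x u (bweight x blk)) + 2 * cost x (\sum_(z <- s) x z + bweight x blk) [:: blk].
Proof.
case: blk => o b us uin dsym d0 dat dcb; rewrite qform_bump // /bweight /= wt_nil.
set P := \sum_(z <- s) d u z * x z; set W := \sum_(z <- s) x z.
have PW c : c \in blabels (o, b) -> \sum_(z <- s) d c z * x z = P + W.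
  move=> cin; rewrite -big_split /=; apply: eq_big_seq => z zs.
  by rewrite dat // mulrDl mul1r.
have bin : b \in blabels (o, b) by rewrite /blabels mem_cat inE eqxx orbT.
case: o dat dcb PW bin => [c|] dat dcb PW bin /=.
  rewrite qform_cons // qform_cons // big_cons PW // PW ?dcb //; last by rewrite inE eqxx.
  by ring.
by rewrite qform_cons // PW //; ring.
Qed.

End Forms.

Lemma lab_nil (T : eqType) : labels [::] = [::] :> seq T. Proof. by []. Qed.

Arguments labels {T} A : simpl never.

(** * Chains as sets of positions on a line *)

Section Positions.
Variables (R : realFieldType) (T : eqType).
Implicit Types (x : T -> R) (pi : T -> nat).

(* Chains are drawn on a line: the path vertices at the even positions, the apex of the
   triangle over [2t, 2t+2] at position [2t+1]. *)
Definition dpos (a b : nat) : R := (a - b + (b - a) + odd a + odd b)%N%:R / 2.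
(** The position formula gives 1 at two equal odd positions, so the diagonal is set apart. *)
Definition dpi pi (u v : T) : R := if u == v then 0 else dpos (pi u) (pi v).

Lemma dpos_sym a b : dpos a b = dpos b a.
Proof. by rewrite /dpos; congr (_%:R / _); lia. Qed.
Lemma dpos_mirror m a b : (a <= 2 * m)%N -> (b <= 2 * m)%N ->
  dpos (2 * m - a) (2 * m - b) = dpos a b.
Proof.
move=> am bm; rewrite /dpos !oddB // mul2n odd_double /= -mul2n.
by congr ((_ + _ + _)%N%:R / _); move: am bm; clear; lia.
Qed.

Lemma dpi_sym pi u v : dpi pi u v = dpi pi v u.
Proof. by rewrite /dpi eq_sym dpos_sym. Qed.
Lemma dpi0 pi u : dpi pi u u = 0. Proof. by rewrite /dpi eqxx. Qed.

Lemma dpi_ge0 pi u v : 0 <= dpi pi u v.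
Proof. by rewrite /dpi; case: ifP => // _; rewrite /dpos divr_ge0 ?ler0n. Qed.

Lemma dpi_gt0 pi u v : injective pi -> u != v -> 0 < dpi pi u v.
Proof.
move=> inj uv; rewrite /dpi (negPf uv) /dpos divr_gt0 // ltr0n.
by have : pi u != pi v; [apply: contraNneq uv => /inj-> | lia].
Qed.

Lemma dposS a b c e : (a - b + (b - a) + odd a + odd b = c - e + (e - c) + odd c + odd e + 2)%N ->
  dpos a b = dpos c e + 1.
Proof. by rewrite /dpos => ->; rewrite natrD; field. Qed.

Fixpoint coded pi v n (A : seq (option T * T)) : Prop :=
  pi v = n /\
  if A is (o, v1) :: A1 then
    (if o is Some y then pi y = n.+1 else True) /\ coded pi v1 n.+2 A1
  else True.

Lemma eq_coded pi pi' v n A : {in v :: labels A, pi =1 pi'} -> coded pi v n A -> coded pi' v n A.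
Proof.
elim: A v n => [|[o v1] A IH] v n E /= [h1 h2].
  by split=> //; rewrite -E ?inE ?eqxx.
have E1 : pi' v = n by rewrite -E ?inE ?eqxx.
split=> //; case: h2 => h2 h3; split.
  by case: o E h2 => // y E <-; rewrite -E // lab_cons !inE eqxx orbT.
apply: IH h3 => u uin; apply: E; rewrite inE lab_cons mem_cat; apply/orP; right.
by apply/orP; right.
Qed.

Lemma coded_exists v n A : uniq (v :: labels A) -> exists pi, coded pi v n A.
Proof.
elim: A v n => [|[o v1] A IH] v n; first by exists (fun _ => n).
rewrite lab_cons => /= /andP[vn]; rewrite cat_uniq => /and3P[uo no un].
have [pi cpi] := IH v1 n.+2 un.
exists (fun u => if u == v then n else if Some u == o then n.+1 else pi u).
split; first by rewrite eqxx.
split.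
  case: o vn uo no => // y; rewrite inE negb_or => /andP[yv _] _ _.
  by rewrite eq_sym (negPf yv) eqxx.
apply: eq_coded cpi => u uin /=.
case: eqP => [uv|_]; first by move: vn; rewrite -uv mem_cat uin orbT.
case: eqP => [uo'|//]; move/hasPn: no => /(_ u uin).
by rewrite -uo' inE eqxx.
Qed.

Lemma coded_ge pi v n A u : coded pi v n A -> u \in v :: labels A -> (n <= pi u)%N.
Proof.
elim: A v n => [|[o v1] A IH] v n /= [h1 h2].
  by rewrite lab_nil inE => /eqP->; rewrite h1.
rewrite lab_cons inE mem_cat => /or3P[/eqP->|uo|uin]; first by rewrite h1.
  by case: o uo h2 => // y; rewrite inE => /eqP-> [-> _]; lia.
by case: h2 => _ h2; have := IH _ _ h2 uin; lia.
Qed.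

(** The chain is grown from its far end: [v] and the apex of the first block, if any, are attached
    at the gate [v1]. Evenness of [n] puts path vertices at even positions. *)
Lemma qform_coded pi v n A x : ~~ odd n -> uniq (v :: labels A) -> coded pi v n A ->
  qform (dpi pi) (v :: labels A) x = 2 * cost x (x v + weight x A) A.
Proof.
elim: A v n x => [|[o v1] A IH] v n x nodd un /=.
  by move=> _; rewrite /qform !big_seq1 dpi0 !mul0r mulr0.
case=> pv [po pA].
move: (un); rewrite lab_cons => un'.
set s := v1 :: labels A.
have pe : perm_eq (v :: olabels o ++ v1 :: labels A) (blabels (o, v) ++ s).
  by rewrite /blabels /=; perm_count.
rewrite (perm_qform _ _ pe).
have unn : uniq (blabels (o, v) ++ s) by rewrite -(perm_uniq pe).
have [ub nbs us] := and3P (etrans (esym (cat_uniq _ _)) unn).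
have pv1 : pi v1 = n.+2 by case: A pA {IH un un' s pe unn ub nbs us} => [|[? ?] ?] [].
rewrite (@qform_attach _ _ _ _ _ v1) //; first last.
- move=> c /= oc; rewrite oc in ub po; rewrite /dpi.
  move: ub; rewrite /= inE => /andP[/negPf-> _].
  rewrite /dpos pv po (_ : (_ + _)%N = 2%N); first by field.
  by rewrite /=; lia.
- move=> b z bin zs.
  have zn : (n.+2 <= pi z)%N := coded_ge pA zs.
  have bz : b != z by apply: contraNneq nbs => E; apply/hasP; exists z => //; rewrite /= -E.
  have pb : pi b = n \/ pi b = n.+1.
    move: bin; rewrite /blabels /= mem_cat inE => /orP[bo|/eqP->]; last by left.
    by right; move: po bo; case: (o) => // y py; rewrite inE => /eqP->.
  rewrite /dpi (negPf bz); case: (eqVneq v1 z) => [vz|_].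
    rewrite -vz pv1 add0r /dpos; case: pb => ->; rewrite (_ : (_ + _)%N = 2%N) ?divff ?pnatr_eq0 //=;
      move: nodd; clear; lia.
  apply: dposS; rewrite pv1; case: pb => -> /=; move: nodd zn; clear; lia.
- exact: dpi0.
- exact: dpi_sym.
- by rewrite inE eqxx.
have v1n : v1 \notin labels A by move: us => /= /andP[].
rewrite (IH v1 n.+2) //; last by rewrite /= negbK.
rewrite bump_in wt_bump // cost_bump // big_cons -wt_lab /bweight !wt_cons /= wt_nil.
have -> : x v1 + (oweight x o + x v) + weight x A = x v + (oweight x o + x v1 + weight x A) by ring.
by ring.
Qed.

Lemma coded_inj pi v n A : coded pi v n A -> {in v :: labels A &, injective pi}.
Proof.
elim: A v n => [|[o v1] A IH] v n /= [h1 h2] u w.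
  by rewrite lab_nil !inE => /eqP-> /eqP->.
case: h2 => ho h2.
rewrite lab_cons !inE !mem_cat.
have pos t : t \in olabels o -> pi t = n.+1.
  by case: o ho => // y hy; rewrite inE => /eqP->.
have inj t t' : t \in olabels o -> t' \in olabels o -> t = t'.
  by case: (o) => // y; rewrite !inE => /eqP-> /eqP->.
have ge t : t \in v1 :: labels A -> (n.+2 <= pi t)%N by apply: coded_ge h2.
case/or3P=> [/eqP->|uo|uA]; case/or3P=> [/eqP->|wo|wA] E //.
- by have := pos _ wo; lia.
- by have := ge _ wA; lia.
- by have := pos _ uo; lia.
- exact: inj.
- by have := pos _ uo; have := ge _ wA; lia.
- by have := ge _ uA; lia.
- by have := ge _ uA; have := pos _ wo; lia.
- exact: (IH _ _ h2).
Qed.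

Lemma coded_image pi v n A k : coded pi v n A ->
  (exists2 u, u \in v :: labels A & pi u = n + k)%N <->
  (k <= 2 * size A)%N && (odd k ==> nth false (pat A) k./2).
Proof.
elim: A v n k => [|[o v1] A IH] v n k /= [h1 h2].
  split=> [[u]|]; first by rewrite lab_nil inE => /eqP-> E; have -> : k = 0%N by lia.
  by case: k => // _; exists v; rewrite ?inE ?eqxx ?addn0.
case: h2 => ho h2.
rewrite lab_cons; case: k => [|[|k]].
- split=> _ //; first by exists v; rewrite ?inE ?eqxx ?addn0.
- rewrite /=; split=> [[u]|].
    rewrite inE mem_cat => /or3P[/eqP->|uo|uA] E; first by lia.
      by case: o uo {ho} => //= *; lia.
    by have := coded_ge h2 uA; lia.
  case: o ho => // y hy _; exists y; last by rewrite hy addn1.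
  by rewrite !inE eqxx orbT.
- rewrite /= negbK; have -> : (k.+2 <= 2 * (size A).+1)%N = (k <= 2 * size A)%N by lia.
  rewrite -(IH v1 n.+2 k h2); split=> [[u uin E]|[u uin E]].
    exists u; last by lia.
    move: uin; rewrite inE mem_cat => /or3P[/eqP uv|uo|//]; first by rewrite uv in E; lia.
    by case: o ho uo => // y hy; rewrite mem_seq1 => /eqP uy; rewrite uy in E; lia.
  by exists u; [rewrite inE mem_cat uin !orbT | lia].
Qed.

(* The positions occupied by [S(p,q;l)], whose path occupies [0, 2, ..., 2(p+q+l)]. *)
Definition posok p q l s : bool :=
  (s <= 2 * (p + q + l))%N && (odd s ==> ((s < 2 * p) || (2 * (p + l) < s))%N).

(** Stands for an isomorphism with [S(p,q;l)]: adjacency and distance are functions of positions, so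
    two shapes with the same parameters are matched by position alone. *)
Definition shape p q l pi : Prop :=
  injective pi /\ forall s, (exists u, pi u = s) <-> posok p q l s.

End Positions.

Lemma chain_shape (R : realFieldType) (T : finType) v (A : seq (option T * T)) p l q :
  perm_eq (v :: labels A) (enum T) -> pat A = nseq p true ++ nseq l false ++ nseq q true ->
  exists2 pi : T -> nat, shape p q l pi &
    forall y : T -> R, qform (dpi R pi) (enum T) y = 2 * chain_form y v [::] A.
Proof.
move=> pe pA.
have un : uniq (v :: labels A) by rewrite (perm_uniq pe) enum_uniq.
have inT u : u \in v :: labels A by rewrite (perm_mem pe) mem_enum.
have [pi cpi] := coded_exists 0 un.
exists pi; last first.
  by move=> y; rewrite -(perm_qform _ _ pe) (qform_coded _ _ un cpi) // /chain_form wt_nil addr0 add0r.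
split=> [u w E|s]; first exact: (coded_inj cpi).
have sA : size A = (p + l + q)%N.
  by rewrite -[size A](size_map (fun b => isSome b.1)) -/(pat A) pA !size_cat !size_nseq addnA.
have := coded_image s cpi; rewrite sA pA => -[h1 h2].
have E : posok p q l s = (s <= 2 * (p + l + q))%N &&
   (odd s ==> nth false (nseq p true ++ nseq l false ++ nseq q true) s./2).
  rewrite /posok !nth_cat !size_nseq !nth_nseq.
  have := odd_double_half s; case: (odd s) => /= sE; last by lia.
  do ! case: ifP => ?; lia.
rewrite E; split=> [[u us]|/h2 [u _ us]]; last by exists u.
by apply: h1; exists u.
Qed.

(** * Graph distance through paths *)

Section Dist.
Variables (T : finType) (e : rel T).

Lemma ballP u v m : reflect (exists p, [/\ path e u p, last u p = v & size p <= m]%N)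
  (v \in ball e u m).
Proof.
apply: (iffP idP).
  elim: m v => [|m IH] v; first by rewrite inE => /eqP->; exists [::].
  rewrite /ball iterS !inE => /orP[/IH[p [h1 h2 h3]]|]; first by exists p; split=> //; lia.
  case/existsP=> w /andP[/IH[p [h1 h2 h3]] ewv].
  by exists (rcons p v); rewrite rcons_path h1 h2 last_rcons size_rcons.
elim: m v => [|m IH] v [p [h1 h2 h3]].
  by case: p h1 h2 h3 => //= _ -> _; rewrite inE.
rewrite /ball iterS !inE -/(ball e u m).
case/lastP: p h1 h2 h3 => [_ <- _|p w]; first by rewrite IH //; exists [::].
rewrite rcons_path last_rcons size_rcons => /andP[h1 h2] <- h3.
apply/orP; right; apply/existsP; exists (last u p); rewrite h2 andbT.
by apply: IH; exists p.
Qed.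

Lemma dist_leP u v m : connect e u v ->
  reflect (exists p, [/\ path e u p, last u p = v & size p <= m]%N) (dist e u v <= m)%N.
Proof.
move=> cuv.
have hb : has (fun m => v \in ball e u m) (iota 0 #|T|).
  have /connectP[p0 ep0 vE] := cuv.
  case: (shortenP ep0) vE => p ep up _ vE.
  (* A path without repetition has fewer than [#|T|] steps, so the search range in [dist]
     suffices. *)
  apply/hasP; exists (size p); last by apply/ballP; exists p.
  rewrite mem_iota /= add0n -[X in (X <= _)%N]/(size (u :: p)) -(card_uniqP up).
  exact: max_card.
have dlt : (dist e u v < #|T|)%N by rewrite -[X in (_ < X)%N](size_iota 0) -has_find.
apply: (iffP idP) => [le|ex].
  have := nth_find 0 hb; rewrite -/(dist e u v) nth_iota // add0n => /ballP[p [h1 h2 h3]].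
  by exists p; split=> //; exact: leq_trans le.
rewrite leqNgt; apply/negP => lt.
have := before_find 0 lt; rewrite nth_iota ?add0n; last exact: ltn_trans dlt.
by move/ballP.
Qed.

(** The Lipschitz condition bounds the length of every path from below; descending through
    predecessors yields a path of that length, hence connectedness too. *)
Lemma dist_unique (delta : T -> nat) u : delta u = 0%N ->
  (forall v w, e v w -> (delta w <= (delta v).+1)%N) ->
  (forall v, v != u -> exists2 w, e w v & delta v = (delta w).+1) ->
  forall v, connect e u v /\ dist e u v = delta v.
Proof.
move=> d0 lip prd v.
have low p w : path e w p -> (delta (last w p) <= delta w + size p)%N.
  elim: p w => [|t p IH] w /=; first by rewrite addn0.
  by case/andP=> /lip h /IH; lia.
have ex n w : delta w = n -> exists p, [/\ path e u p, last u p = w & size p <= n]%N.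
  elim: n w => [|n IH] w dw.
    case: (eqVneq w u) => [->|/prd[t _]]; [by exists [::] | by rewrite dw].
  case: (eqVneq w u) => [->|/prd[t etw]]; first by exists [::].
  rewrite dw => -[/esym/IH[p [h1 h2 h3]]].
  by exists (rcons p w); rewrite rcons_path h1 h2 last_rcons size_rcons.
have [p [h1 h2 h3]] := ex _ v erefl.
have cuv : connect e u v by apply/connectP; exists p.
split=> //; apply/eqP; rewrite eqn_leq; apply/andP; split; first by apply/(dist_leP _ cuv); exists p.
have /(dist_leP _ cuv)[p' [g1 g2 g3]] := leqnn (dist e u v).
by have := low _ _ g1; rewrite g2 d0; lia.
Qed.

Hypothesis conn : connected_graph e.

Lemma dist_path u v : exists p, [/\ path e u p, last u p = v & size p = dist e u v].
Proof.
have /(dist_leP _ (conn u v))[p [g1 g2 g3]] := leqnn (dist e u v).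
exists p; split=> //; apply/eqP; rewrite eqn_leq g3 /=.
by apply/(dist_leP _ (conn u v)); exists p.
Qed.

Lemma dist_le_size u p : path e u p -> (dist e u (last u p) <= size p)%N.
Proof. by move=> ep; apply/(dist_leP _ (conn _ _)); exists p. Qed.

Lemma dist0 u : dist e u u = 0%N.
Proof. by apply/eqP; rewrite -leqn0; apply: (@dist_le_size u [::]). Qed.

Lemma dist_eq0 u v : dist e u v = 0%N -> u = v.
Proof. by have [p [_ <- <-]] := dist_path u v; case: p. Qed.

Lemma dist_eq1 u v : irreflexive e -> (dist e u v == 1%N) = e u v.
Proof.
move=> irr; apply/idP/idP => [/eqP|euv].
  have [p [ep lp <-]] := dist_path u v.
  by case: p ep lp => [|w [|]] //= /andP[ew _] <-.
have := @dist_le_size u [:: v]; rewrite /= euv => /(_ isT).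
rewrite leq_eqVlt ltnS leqn0 => /orP[//|/eqP/dist_eq0 uv].
by rewrite uv irr in euv.
Qed.

Lemma dist_sym : symmetric e -> forall u v, dist e u v = dist e v u.
Proof.
move=> es; have le u v : (dist e v u <= dist e u v)%N.
  have [p [ep lp <-]] := dist_path u v.
  have := @dist_le_size v (rev (belast u p)).
  rewrite -lp rev_path (eq_path (e' := e)); last by move=> x y; exact: es.
  move=> /(_ ep); rewrite size_rev size_belast.
  by case: p {ep lp} => [|w p] //; rewrite /= rev_cons last_rcons.
by move=> u v; apply/eqP; rewrite eqn_leq !le.
Qed.

End Dist.

(** * Distances in [S(p,q;l)] read off from positions *)

Section ShapeDist.
Variables (T : finType) (e : rel T) (p q l : nat) (pi : T -> nat).
Hypothesis sh : shape p q l pi.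

Definition dposn (a b : nat) : nat := (a - b + (b - a) + odd a + odd b)%N.

Hypothesis adj : forall u v, e u v = (u != v) && (dposn (pi u) (pi v) == 2)%N.

Lemma shape_even t : (t <= p + q + l)%N -> exists u, pi u = t.*2.
Proof.
by move=> h; apply/sh.2; rewrite /posok odd_double /= andbT; lia.
Qed.

Lemma half_dposn_le a b c : dposn b c = 2 -> ((dposn a c)./2 <= ((dposn a b)./2).+1)%N.
Proof.
move=> bc; apply: (@half_leq _ (dposn a b).+2); move: bc; rewrite /dposn.
by move: (nat_of_bool (odd a)) (nat_of_bool (odd b)) (nat_of_bool (odd c)) => x y z; clear; lia.
Qed.

Lemma dposn_bits (b c : bool) g h :
  dposn (b + g.*2) (c + h.*2) = (b + g.*2 - (c + h.*2) + (c + h.*2 - (b + g.*2)) + b + c)%N.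
Proof. by rewrite /dposn !oddD !odd_double !addbF !oddb. Qed.

(** The last step to [w] is taken from a path vertex, since even positions up to the end are all
    occupied, while odd ones may be empty. *)
Lemma step_towards u w : u != w -> dposn u w != 2%N -> exists2 g, (g.*2 <= maxn u w)%N &
  dposn g.*2 w = 2%N /\ dposn u w = (dposn u g.*2).+2.
Proof.
rewrite -(odd_double_half u) -(odd_double_half w).
move: (odd u) (odd w) (u./2) (w./2) => b c g h ne; move=> n2; rewrite dposn_bits in n2.
have main k : (k.*2 <= maxn (b + g.*2) (c + h.*2))%N ->
    (k.*2 - (c + h.*2) + (c + h.*2 - k.*2) + c = 2)%N ->
    (b + g.*2 - (c + h.*2) + (c + h.*2 - (b + g.*2)) + c = (b + g.*2 - k.*2 + (k.*2 - (b + g.*2))).+2)%N ->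
    exists2 g0, (g0.*2 <= maxn (b + g.*2) (c + h.*2))%N &
  dposn g0.*2 (c + h.*2) = 2%N /\ dposn (b + g.*2) (c + h.*2) = (dposn (b + g.*2) g0.*2).+2.
  move=> le e1 e2; exists k => //.
  rewrite (dposn_bits false c k h) (dposn_bits b c) (dposn_bits b false g k) !add0n !addn0 e1.
  by split=> //; rewrite addnAC e2 !addSn.
(* The path vertex next to [w] on the side of [u]: on the left at [2h] if [w] is an apex ([c] true)
   and at [2h - 2] otherwise, on the right at [2h + 2] in both cases. *)
case: (boolP (b + g.*2 < c + h.*2)%N) => lt.
  by apply: (main (h - ~~ c)%N); move: lt ne n2; clear; case: b; case: c; rewrite -!muln2 /=; lia.
by apply: (main h.+1); move: lt ne n2; clear; case: b; case: c; rewrite -!muln2 /=; lia.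
Qed.

Lemma dist_shape u v : connect e u v /\
  dist e u v = if u == v then 0%N else (dposn (pi u) (pi v))./2.
Proof.
apply: (@dist_unique _ _ (fun v => if u == v then 0%N else (dposn (pi u) (pi v))./2)).
- by rewrite eqxx.
- move=> w t; rewrite adj => /andP[weight /eqP E].
  case: eqP => [_|_]; first by lia.
  case: eqP => [->|_]; first by rewrite E.
  exact: half_dposn_le.
- move=> w wu; rewrite [u == w]eq_sym (negPf wu).
  have puw : pi u != pi w by apply: contraNneq wu => /sh.1 ->.
  case E : (dposn (pi u) (pi w) == 2%N).
    exists u; first by rewrite adj E eq_sym wu.
    by rewrite eqxx (eqP E).
  have /sh.2/andP[hw _] : exists v, pi v = pi w by exists w.
  have /sh.2/andP[hu _] : exists v, pi v = pi u by exists u.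
  have [g gle [dgw dug]] := step_towards puw (negbT E).
  have [t pt] : exists t, pi t = g.*2.
    by apply: shape_even; move: hw hu gle; rewrite -muln2; clear; lia.
  have tw : t != w.
    by apply: contra_eqN dgw => /eqP<-; rewrite pt /dposn odd_double subnn.
  exists t; first by rewrite adj tw pt dgw.
  case: eqP => [ut|_]; last by rewrite dug pt.
  by move: E; rewrite ut pt dgw.
Qed.

End ShapeDist.

Section SRel.
Variables p q l : nat.

Definition spos (x : nat) : nat :=
  if (x < p + q + l + 1)%N then x.*2 else (wbase p q l (x - (p + q + l + 1))).*2.+1.

Lemma spos_shape : shape p q l (fun x : 'I_(2 * (p + q) + l + 1) => spos x).
Proof.
split=> [x y|s].
  move=> E; apply: val_inj; move: E (ltn_ord x) (ltn_ord y); rewrite /spos /wbase /=.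
  move: (val x) (val y) => i j; do ! case: ifP => ?; lia.
split=> [[x <-]|].
  move: (ltn_ord x); rewrite /posok /spos /wbase; move: (val x) => i.
  do ! case: ifP => ?; rewrite /= ?odd_double /=; lia.
rewrite /posok; case: (boolP (odd s)) => os /= /andP[h1 h2].
  have lt : ((p + q + l + 1) + (if s./2 < p then s./2 else s./2 - l) < 2 * (p + q) + l + 1)%N.
    by move: h2; case: ifP => ?; lia.
  exists (Ordinal lt); rewrite /spos /wbase /=; case: ifP => h; first by lia.
  by rewrite addKn; case: (ltnP s./2 p) => h3; [rewrite h3; lia | case: ifP; lia].
have lt : (s./2 < 2 * (p + q) + l + 1)%N by lia.
by exists (Ordinal lt); rewrite /spos /=; case: ifP => h; lia.
Qed.

Lemma spos_adj (x y : 'I_(2 * (p + q) + l + 1)) :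
  S_rel p q l x y = (x != y) && (dposn (spos x) (spos y) == 2)%N.
Proof.
rewrite -val_eqE; move: (ltn_ord x) (ltn_ord y); rewrite /S_rel /S_adj /spos /w_adj /wbase /dposn /=.
move: (val x) (val y) => i j hi hj.
do ! case: ifP => ?; rewrite /= ?odd_double /=; lia.
Qed.

Lemma S_rel_simple : simple_graph (S_rel p q l).
Proof.
split=> [x y|x]; rewrite !spos_adj ?eqxx //.
by rewrite eq_sym; congr (_ && (_ == _)); rewrite /dposn; lia.
Qed.

End SRel.

(** * Growing a cactus block by block *)

Section Growth.
Local Open Scope nat_scope.
Variables (T : finType) (e : rel T).
Hypothesis simple : simple_graph e.
Hypothesis cact : cactus e.
Hypothesis cyc3 : all_cycles_triangles e.

Let es : symmetric e := simple.1.
Let ei : irreflexive e := simple.2.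
Let conn : connected_graph e := cact.1.

Lemma adj_neq u v : e u v -> u != v.
Proof. by apply: contraTneq => ->; rewrite ei. Qed.

(** Distinct vertices with the same edge to their successors would be successors of each other,
    closing the cycle after two steps. *)
Lemma card_cyc_edges (s : seq T) : 2 < size s -> uniq s -> #|cyc_edges s| = size s.
Proof.
move=> s2 us; rewrite card_in_imset; first exact/card_uniqP.
move=> x y xs ys E; apply/eqP; apply: contraT => xy.
have nxt : next s x = y /\ next s y = x.
  have : y \in [set x; next s x] by rewrite E !inE eqxx.
  have : x \in [set y; next s y] by rewrite -E !inE eqxx.
  rewrite !inE (eq_sym y) (negPf xy) /= => /eqP -> /eqP h.
  by rewrite [in RHS]h.
have [i s' rs] := rot_to xs.
have ur : uniq (rot i s) by rewrite rot_uniq.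
have sr : size (rot i s) = size s by rewrite size_rot.
move: nxt; rewrite -!(next_rot i us) rs.
move: ur sr s2; rewrite rs; case: s' {rs} => [|y1 [|y2 t]] /=; [lia | lia |].
rewrite !inE !negb_or -!andbA => /and5P[xy1 xy2 _ _ _] _ _.
rewrite eqxx => -[yE]; rewrite -yE eq_sym (negPf xy1) eqxx => xE.
by move: xy2; rewrite xE eqxx.
Qed.

Definition tri a b c := [&& e a b, e b c & e a c].

Definition pairs (t : {set T}) : {set {set T}} := [set E : {set T} | (E \subset t) & (#|E| == 2)].

Lemma cyc_edges3 (a b c : T) : a != b -> b != c -> a != c ->
  cyc_edges [:: a; b; c] = pairs [set a; b; c].
Proof.
move=> ab bc ac; apply/setP => E; rewrite !inE.
have na : next [:: a; b; c] a = b by rewrite /= eqxx.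
have nb : next [:: a; b; c] b = c by rewrite /= (eq_sym b a) (negPf ab) eqxx.
have nc : next [:: a; b; c] c = a by rewrite /= (eq_sym c a) (eq_sym c b) (negPf ac) (negPf bc) eqxx.
apply/imsetP/idP => [[x]|/andP[sub /cards2P[x [y [xy EE]]]]].
  rewrite !inE => /or3P[] /eqP-> ->; rewrite ?na ?nb ?nc.
  - by rewrite subUset !sub1set !inE !eqxx ?orbT cards2 ab.
  - by rewrite subUset !sub1set !inE !eqxx ?orbT cards2 bc.
  - by rewrite subUset !sub1set !inE !eqxx ?orbT cards2 (eq_sym c) ac.
move: sub; rewrite EE subUset !sub1set !inE -!orbA => /andP[].
case/or3P=> /eqP xE; case/or3P=> /eqP yE; rewrite xE yE ?eqxx // in xy *.
- by exists a; rewrite ?inE ?eqxx ?na.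
- by exists c; rewrite ?inE ?eqxx ?orbT ?nc // setUC.
- by exists a; rewrite ?inE ?eqxx ?na // setUC.
- by exists b; rewrite ?inE ?eqxx ?orbT ?nb.
- by exists c; rewrite ?inE ?eqxx ?orbT ?nc.
- by exists b; rewrite ?inE ?eqxx ?orbT ?nb // setUC.
Qed.

Lemma tri_neq a b c : tri a b c -> [/\ a != b, b != c & a != c].
Proof. by case/and3P=> /adj_neq ? /adj_neq ? /adj_neq ?. Qed.

Lemma tri_swap a b c : tri a b c = tri b a c.
Proof. by rewrite /tri (es a b) [e b c && _]andbC. Qed.

Lemma tri_rot a b c : tri a b c = tri b c a.
Proof. by rewrite /tri (es a c) (es a b) andbC -andbA; congr (_ && _); rewrite andbC. Qed.

Lemma is_cycleP F : is_cycle e F <-> exists a b c, tri a b c /\ F = pairs [set a; b; c].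
Proof.
split=> [cF|[a [b [c [t ->]]]]].
  have c3 := cyc3 cF; case: cF c3 => s [/and3P[s2 cs us] ->].
  rewrite card_cyc_edges // => s3.
  case: s s3 s2 cs us => [|a [|b [|c []]]] //= _ _.
  rewrite andbT => /and3P[eab ebc eca] us.
  have t : tri a b c by rewrite /tri eab ebc es eca.
  by exists a, b, c; split=> //; have [? ? ?] := tri_neq t; rewrite cyc_edges3.
have [ab bc ac] := tri_neq t.
exists [:: a; b; c]; rewrite cyc_edges3 //; split=> //.
have /and3P[h1 h2 h3] := t.
by rewrite /cycle_seq /= h1 h2 es h3 !inE negb_or ab ac bc.
Qed.

Lemma cover_pairs (a b c : T) : a != b -> b != c -> a != c ->
  cyc_vertices (pairs [set a; b; c]) = [set a; b; c].
Proof.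
move=> ab bc ac; apply/setP => x; apply/bigcupP/idP => [[E]|].
  by rewrite inE => /andP[/subsetP h _] /h.
rewrite !inE -orbA => /or3P[] /eqP->.
- by exists [set a; b]; rewrite !inE ?subUset ?sub1set ?inE ?eqxx ?orbT ?cards2 ?ab.
- by exists [set a; b]; rewrite !inE ?subUset ?sub1set ?inE ?eqxx ?orbT ?cards2 ?ab.
- by exists [set b; c]; rewrite !inE ?subUset ?sub1set ?inE ?eqxx ?orbT ?cards2 ?bc.
Qed.

(** Two triangles on one edge would be distinct cycles with two common vertices. *)
Lemma tri_unique a b c c' : tri a b c -> tri a b c' -> c = c'.
Proof.
move=> t t'; apply/eqP; apply: contraT => cc'.
have [ab bc ac] := tri_neq t; have [_ bc' ac'] := tri_neq t'.
have h : is_cycle e (pairs [set a; b; c]) by apply/is_cycleP; exists a, b, c.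
have h' : is_cycle e (pairs [set a; b; c']) by apply/is_cycleP; exists a, b, c'.
have ne : pairs [set a; b; c] <> pairs [set a; b; c'].
  move=> E; have : c \in cyc_vertices (pairs [set a; b; c']).
    by rewrite -E cover_pairs // !inE eqxx orbT.
  by rewrite cover_pairs // !inE (eq_sym c a) (negPf ac) (eq_sym c b) (negPf bc) (negPf cc').
have := cact.2 _ _ h h' ne; rewrite !cover_pairs // => le1.
have : #|[set a; b]| <= 1.
  apply: leq_trans le1; apply: subset_leq_card; apply/subsetP => x.
  by rewrite !inE => /orP[] ->; rewrite ?orbT.
by rewrite cards2 ab.
Qed.

(** The vertex sets met when growing by whole blocks; the last clause rules out a triangle with just
    two vertices in [s]. *)
Definition good (s : seq T) : Prop :=
  [/\ uniq s,
      forall a b, a \in s -> b \in s ->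
        exists p, [/\ path e a p, last a p = b & {subset p <= s}] &
      forall a b c, a \in s -> b \in s -> tri a b c -> c \in s].

(* Otherwise a path leaving and reentering [s] at distinct vertices closes up inside [s] to a
   cycle, hence to a triangle with exactly two vertices in [s]. *)
Lemma gate s u b p : good s -> u \in s -> b \notin s -> e u b -> path e b p ->
  last b p \in s -> u \in p.
Proof.
move=> [us cs ts] uin bn eub ep lp.
have hp : has (mem s) p.
  apply/hasP; exists (last b p) => //.
  by case: p lp {ep} => [|x p _] /=; [rewrite (negPf bn) | exact: mem_last].
move: ep lp; case: (split_find hp) => w p1 p2 ws np1.
rewrite cat_path last_cat rcons_path -andbA last_rcons => /and3P[ep1 ew _] _.
case: (eqVneq w u) => [<-|wu]; first by rewrite mem_cat mem_rcons inE eqxx.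
have [r0 [er0 lr0 sr0]] := cs _ _ ws uin.
have [q [eq uq lq sq]] : exists q, [/\ path e b q, uniq (b :: q), last b q = last b p1 & {subset q <= p1}].
  by case: (shortenP ep1) => q ? ? ?; exists q; split.
have [r [er ur lr sr]] : exists r, [/\ path e w r, uniq (w :: r), last w r = u & {subset r <= s}].
  case: (shortenP er0) lr0 => r h1 h2 h3 h4; exists r; split=> //.
  by move=> x /h3/sr0.
have outq x : x \in q -> x \notin s.
  by move/sq => xp; apply: contra np1 => xs; apply/hasP; exists x.
have size3 : size (b :: q ++ w :: r) = 3.
  have s2 : 2 < size (b :: q ++ w :: r).
    rewrite /= size_cat /=; case: r lr {er ur sr} => [|x r] /=; last by rewrite !addnS.
    by move=> wE; rewrite wE eqxx in wu.
  have uc : uniq (b :: q ++ w :: r).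
    move: uq => /= /andP[bq uq]; rewrite mem_cat negb_or bq inE negb_or /=.
    rewrite cat_uniq uq /=; apply/and3P; split.
    - apply/andP; split; first by apply: contraNneq bn => ->.
      by apply: contra bn => /sr.
    - apply/norP; split; first by apply: contraL ws => /outq.
      by apply/hasPn => x /sr xs; apply: contraL xs => /outq.
    - exact: ur.
  rewrite -card_cyc_edges //; apply: cyc3; exists (b :: q ++ w :: r); split=> //.
  rewrite /cycle_seq s2 uc andbT /=.
  by rewrite rcons_path cat_path eq /= lq ew er last_cat /= lr eub.
move: size3; rewrite /= size_cat /=.
have rs0 : 0 < size r.
  by case: (r) lr => [|? ?] //= wE; rewrite wE eqxx in wu.
move=> size3; have q0 : size q = 0 by move: size3 rs0; clear; lia.
have r1 : size r = 1 by move: size3 rs0; clear; lia.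
move: q0 => /size0nil q0; rewrite q0 /= in lq.
case: r lr er r1 {ur sr rs0 size3} => [|x [|? ?]] //= xu /andP[ewx _] _.
case/negP: bn; apply: (ts w u) => //.
by rewrite /tri -xu ewx xu eub es lq ew.
Qed.

Lemma gate_adj s u b z : good s -> u \in s -> b \notin s -> e u b -> z \in s -> e z b -> z = u.
Proof.
move=> gs us bn eub zs ezb.
have := @gate s u b [:: z] gs us bn eub; rewrite /= es ezb => /(_ isT zs).
by rewrite inE => /eqP.
Qed.

Lemma dist_gate s u b z : good s -> u \in s -> b \notin s -> e u b -> z \in s ->
  dist e b z = (dist e u z).+1.
Proof.
move=> gs us bn eub zs; apply/eqP; rewrite eqn_leq; apply/andP; split.
  have [p [ep <- <-]] := dist_path conn u z.
  by have := @dist_le_size _ _ conn b (u :: p); rewrite /= es eub ep; apply.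
have [p [ep lp <-]] := dist_path conn b z.
have := gate gs us bn eub ep; rewrite lp => /(_ zs) up.
case/splitPr: up ep lp => p1 p2; rewrite cat_path last_cat /= => /and3P[_ _ ep2] <-.
by have := dist_le_size conn ep2; rewrite size_cat /=; lia.
Qed.

Definition istri (t : {set T}) : bool :=
  [exists a, [exists b, [exists c, tri a b c && (t == [set a; b; c])]]].

Lemma istriP t : reflect (exists a b c, tri a b c /\ t = [set a; b; c]) (istri t).
Proof.
apply: (iffP existsP) => [[a /existsP[b /existsP[c /andP[h /eqP->]]]]|[a [b [c [h ->]]]]].
  by exists a, b, c.
by exists a; apply/existsP; exists b; apply/existsP; exists c; rewrite h eqxx.
Qed.

Lemma istri_mem t b : istri t -> b \in t -> exists x y, tri b x y /\ t = [set b; x; y].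
Proof.
case/istriP=> [a [a' [c [h ->]]]]; rewrite !inE -orbA => /or3P[] /eqP->.
- by exists a', c.
- exists a, c; rewrite tri_swap; split=> //; apply/setP => z; rewrite !inE.
  by rewrite (orbC (z == a)).
- exists a, a'; rewrite tri_rot; split=> //; apply/setP => z; rewrite !inE.
  by rewrite orbC orbA.
Qed.

Definition tris (s : seq T) : {set {set T}} := [set t | istri t & t \subset s].

Lemma card_all_cycles (C : {set {set {set T}}}) s : (forall F, F \in C <-> is_cycle e F) ->
  s =i predT -> #|C| = #|tris s|.
Proof.
move=> CP sT.
have -> : C = pairs @: tris s.
  apply/setP => F; apply/idP/imsetP => [/CP/is_cycleP[a [b [c [h ->]]]]|[t]].
    exists [set a; b; c] => //; rewrite inE; apply/andP; split; first by apply/istriP; exists a, b, c.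
    by apply/subsetP => x _; rewrite sT.
  by rewrite inE => /andP[/istriP[a [b [c [h ->]]]] _] ->; apply/CP/is_cycleP; exists a, b, c.
rewrite card_in_imset // => t t'; rewrite !inE.
move=> /andP[/istriP[a [b [c [/tri_neq[? ? ?] ->]]]] _] /andP[/istriP[a' [b' [c' [/tri_neq[? ? ?] ->]]]] _].
by move=> E; rewrite -[LHS]cover_pairs // E cover_pairs.
Qed.

Section Step.
Variables (s : seq T) (u b : T) (o : option T).
Hypotheses (gs : good s) (us : u \in s) (bn : b \notin s) (eub : e u b).
Hypothesis oP : if o is Some c then is_true (tri u b c) else forall c, ~~ tri u b c.

Lemma step_new x : x \in blabels (o, b) -> x \notin s /\ e u x.
Proof.
rewrite /blabels mem_cat inE => /orP[|/eqP->]; last by [].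
case: o oP => //= c t; rewrite inE => /eqP->; have /and3P[_ _ euc] := t; split=> //.
apply: contra bn => cs; have [_ _ ts] := gs; apply: (ts u c) => //.
by rewrite tri_rot tri_swap -tri_rot.
Qed.

Lemma step_uniq : uniq (blabels (o, b) ++ s).
Proof.
have [un _ _] := gs; rewrite cat_uniq un andbT; apply/andP; split.
  by case: o oP => //= c t; rewrite !inE andbT eq_sym; have [_ ? _] := tri_neq t.
by apply/hasPn => x xs; apply/negP => /step_new[]; rewrite xs.
Qed.

Lemma step_tri x y : x \in blabels (o, b) -> tri u x y -> y \in blabels (o, b).
Proof.
case: o oP => [c t|nt]; rewrite /blabels /= !inE.
  case/orP=> /eqP-> t'.
    have tt : tri u c b by rewrite tri_rot tri_swap -tri_rot.
    by rewrite (tri_unique tt t') eqxx orbT.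
  by rewrite (tri_unique t t') eqxx.
by move/eqP->; rewrite (negPf (nt _)).
Qed.

Lemma step_new_tri x y z : x \in blabels (o, b) -> y \in blabels (o, b) -> tri x y z -> z = u.
Proof.
move=> xb yb t; have [_ eux] := step_new xb; have [_ euy] := step_new yb.
have /and3P[exy _ _] := t.
have t' : tri x y u by rewrite /tri exy es euy es eux.
exact: (tri_unique t t').
Qed.

Lemma step_old_new x y z : x \in s -> y \in blabels (o, b) -> tri x y z -> z \in blabels (o, b).
Proof.
move=> xs yb t; have [yn euy] := step_new yb; have /and3P[exy _ _] := t.
have xu := gate_adj gs us yn euy xs exy; rewrite xu in t.
exact: step_tri yb t.
Qed.

Lemma step_good : good (blabels (o, b) ++ s).
Proof.
have [_ cs ts] := gs; split; first exact: step_uniq.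
  have tou x : x \in blabels (o, b) ++ s ->
     (exists p, [/\ path e x p, last x p = u & {subset p <= blabels (o, b) ++ s}]) /\
     (exists p, [/\ path e u p, last u p = x & {subset p <= blabels (o, b) ++ s}]).
    rewrite mem_cat => /orP[xb|xs]; last first.
      have [p [h1 h2 h3]] := cs _ _ xs us; have [p' [h1' h2' h3']] := cs _ _ us xs.
      split; [exists p | exists p']; split=> // z zp; rewrite mem_cat.
        by rewrite (h3 _ zp) orbT.
      by rewrite (h3' _ zp) orbT.
    have [_ eux] := step_new xb; split.
      exists [:: u]; split; rewrite /= ?(es x u) ?eux // => z.
      by rewrite inE => /eqP->; rewrite mem_cat us orbT.
    exists [:: x]; split; rewrite /= ?eux // => z.
    by rewrite inE => /eqP->; rewrite mem_cat xb.
  move=> x y /tou[[p [h1 h2 h3]] _] /tou[_ [p' [h1' h2' h3']]].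
  exists (p ++ p'); split; [by rewrite cat_path h1 h2 | by rewrite last_cat h2 |].
  by move=> z; rewrite (mem_cat z p) => /orP[zp|zp]; [exact: h3 | exact: h3'].
move=> x y z; rewrite (mem_cat x) (mem_cat y) (mem_cat z) => /orP[xb|xs] /orP[yb|ys] t; apply/orP.
- by right; rewrite (step_new_tri xb yb t).
- by left; rewrite tri_swap in t; apply: step_old_new ys xb t.
- by left; apply: step_old_new xs yb t.
- by right; apply: ts xs ys t.
Qed.

(** A triangle of the larger set that meets the new block has two vertices there and [u] as its
    third, so the only possible new triangle is the block itself. *)
Lemma step_tris : #|tris (blabels (o, b) ++ s)| = isSome o + #|tris s|.
Proof.
have sub : tris s \subset tris (blabels (o, b) ++ s).
  apply/subsetP => t; rewrite !inE => /andP[-> /subsetP h].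
  by apply/subsetP => x /h; rewrite mem_cat => ->; rewrite orbT.
have new t : t \in tris (blabels (o, b) ++ s) -> t \notin tris s ->
    exists x y, [/\ x \in blabels (o, b), y \in blabels (o, b), tri x y u & t = [set x; y; u]].
  rewrite !inE => /andP[it st]; rewrite it /= => /subsetPn[x xt xs].
  have xb : x \in blabels (o, b) by move/subsetP: st => /(_ _ xt); rewrite mem_cat (negPf xs) orbF.
  have [y [z [t' tE]]] := istri_mem it xt.
  have yin : y \in blabels (o, b) ++ s by move/subsetP: st; apply; rewrite tE !inE eqxx orbT.
  have zin : z \in blabels (o, b) ++ s by move/subsetP: st; apply; rewrite tE !inE eqxx orbT.
  have t'' : tri x z y by rewrite tri_rot tri_swap -tri_rot.
  move: yin zin; rewrite (mem_cat y) (mem_cat z) => /orP[yb _|ys /orP[zb|zs]].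
  - by exists x, y; rewrite -(step_new_tri xb yb t').
  - exists x, z; rewrite -(step_new_tri xb zb t''); split=> //.
    by rewrite tE -!setUA (setUC [set y]).
  - have : z \in blabels (o, b) by apply: (step_old_new ys xb); rewrite tri_swap.
    by case/step_new; rewrite zs.
case: o oP new sub => [c|] tP new sub /=; last first.
  suff -> : tris (blabels (None, b) ++ s) = tris s by [].
  apply/eqP; rewrite eqEsubset sub andbT; apply/subsetP => t tin; apply: contraT => tn.
  have [x [y [xb yb t' _]]] := new t tin tn.
  move: xb yb; rewrite /blabels /= !inE => /eqP xb /eqP yb; rewrite xb yb in t'.
  by have [] := tri_neq t'; rewrite eqxx.
have [ub bc uc] := tri_neq tP.
have t0 : [set u; b; c] \notin tris s.
  rewrite inE negb_and; apply/orP; right; apply/subsetPn; exists b => //.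
  by rewrite !inE eqxx orbT.
have -> : tris (blabels (Some c, b) ++ s) = [set u; b; c] |: tris s; last by rewrite cardsU1 t0.
apply/eqP; rewrite eqEsubset subUset sub andbT sub1set; apply/andP; split; last first.
  rewrite inE; apply/andP; split; first by apply/istriP; exists u, b, c.
  by apply/subsetP => x; rewrite !inE -orbA => /or3P[] /eqP->; rewrite ?eqxx ?us ?orbT.
apply/subsetP => t tin; rewrite in_setU1; case: (boolP (t \in tris s)) => [|tn]; first by rewrite orbT.
have [x [y [xb yb t' ->]]] := new t tin tn.
have [xy _ _] := tri_neq t'; rewrite orbF; apply/eqP/setP => z; rewrite !inE.
move: xb yb xy; rewrite /blabels /= !inE => /orP[] /eqP-> /orP[] /eqP->; rewrite ?eqxx // => _.
  by case: (z == b); case: (z == c); case: (z == u).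
by case: (z == b); case: (z == c); case: (z == u).
Qed.

End Step.

Definition dR (R : realFieldType) (u v : T) : R := (dist e u v)%:R.

(** All positive weights are needed because attaching a block calls the statement at weights bumped
    at the gate. The second alternative, uniform in [y], preserves the equality case. *)
Definition below_chain (R : realFieldType) (s : seq T) : Prop :=
  forall x : T -> R, (forall t, (0 < x t)%R) ->
  exists z A B, [/\ perm_eq (chain_vts z A B) s, ntri A + ntri B = #|tris s| &
    (qform (dR R) s x < 2 * chain_form x z A B)%R \/
    (forall y : T -> R, qform (dR R) s y = 2 * chain_form y z A B)%R].

Lemma step_below (R : realFieldType) s u b o : good s -> u \in s -> b \notin s -> e u b ->
  (if o is Some c then is_true (tri u b c) else forall c, ~~ tri u b c) ->
  below_chain R s -> below_chain R (blabels (o, b) ++ s).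
Proof.
move=> gs us bn eub oP IH x xp.
have wtb y : weight y [:: (o, b)] = bweight y (o, b) by rewrite /weight big_seq1.
have bp : (0 < bweight x (o, b))%R by rewrite -wtb; apply: wt_gt0.
have xp' t : (0 < bump x u (bweight x (o, b)) t)%R.
  by rewrite /bump; case: ifP => _ //; apply: addr_gt0.
have [z [A [B [pe nt cmp]]]] := IH _ xp'.
have [un _ _] := gs.
have un' : uniq (chain_vts z A B) by rewrite (perm_uniq pe).
have us' : u \in chain_vts z A B by rewrite (perm_mem pe).
have [z' [A' [B' [pe' nt' cmp']]]] := attach_block (o, b) xp un' us'.
have tot (y : T -> R) : total y z A B = (\sum_(t <- s) y t)%R.
  by rewrite -(perm_big _ pe) /= /chain_vts big_cons big_cat /= -!wt_lab addrA.
have qE (y : T -> R) : (qform (dR R) (blabels (o, b) ++ s) y =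
    qform (dR R) s (bump y u (bweight y (o, b))) +
    2 * cost y (total y z A B + weight y [:: (o, b)]) [:: (o, b)])%R.
  rewrite tot wtb; apply: qform_attach => //.
  - by move=> v w; rewrite /dR dist_sym.
  - by move=> v; rewrite /dR dist0.
  - move=> c t /(step_new gs us bn eub oP)[cn euc] ts.
    by rewrite /dR (dist_gate gs us) // -natr1.
  - move=> c /= oc; rewrite oc in oP; have /and3P[_ ebc _] := oP.
    by rewrite /dR (eqP (_ : dist e c b == 1)) // dist_eq1 // es.
exists z', A', B'; split.
- by apply: (perm_trans pe'); rewrite perm_cat2l.
- by rewrite nt' nt (step_tris gs us bn eub oP).
- case: cmp => [lt|eq]; case: cmp' => [lt'|eq'].
  + left; rewrite qE; move: lt lt'; rewrite wtb; lra.
  + left; rewrite qE -eq'; move: lt; rewrite wtb; lra.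
  + left; rewrite qE eq; move: lt'; rewrite wtb; lra.
  + by right=> y; rewrite -eq' qE eq wtb; ring.
Qed.

Lemma exit_edge (s : seq T) r t : r \in s -> t \notin s -> exists u b, [/\ u \in s, b \notin s & e u b].
Proof.
have /connectP[p ep ->] := conn r t.
elim: p r ep => [|x p IH] r /=; first by move=> _ ->.
case/andP=> erx ep rs tn; case: (boolP (x \in s)) => xs; first exact: IH ep xs tn.
by exists r, x.
Qed.

Lemma graph_below_chain (R : realFieldType) : 0 < #|T| -> below_chain R (enum T).
Proof.
move=> /card_gt0P[r _].
have main n : forall s, #|T| - size s <= n -> good s -> r \in s -> below_chain R s ->
    below_chain R (enum T).
  elim: n => [|n IH] s sn gs rs bs.
    have [un _ _] := gs.
    have pe : perm_eq s (enum T).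
      apply: uniq_perm => //; first exact: enum_uniq.
      have sT : {subset s <= enum T} by move=> x _; rewrite mem_enum.
      by have [|_ ] := uniq_min_size un sT; first by rewrite -cardE -subn_eq0 -leqn0.
    move=> x xp; have [z [A [B [h1 h2 h3]]]] := bs x xp.
    exists z, A, B; split; first exact: perm_trans h1 pe.
      rewrite h2; congr #|pred_of_set _|; apply/setP => t; rewrite !inE; congr (_ && _).
      by apply: eq_subset_r => y; rewrite (perm_mem pe).
    by case: h3 => h3; [left | right=> y]; rewrite -(perm_qform _ _ pe).
  case: (boolP [forall t, t \in s]) => [/forallP all_s|/forallPn[t tn]].
    apply: (IH s) => //; have [un _ _] := gs.
    have sz : #|T| = size s by rewrite -(card_uniqP un); apply: eq_card => y; rewrite all_s.
    by rewrite sz subnn.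
  have [u [b [us bn eub]]] := exit_edge rs tn.
  have [o oP] : exists o, if o is Some c then is_true (tri u b c) else forall c, ~~ tri u b c.
    case: (boolP [exists c, tri u b c]) => [/existsP[c h]|/existsPn h].
      by exists (Some c).
    by exists None.
  apply: (IH (blabels (o, b) ++ s)).
  - by move: sn; rewrite !size_cat /=; lia.
  - exact: (step_good gs us bn eub oP).
  - by rewrite mem_cat rs orbT.
  - exact: (step_below gs us bn eub oP bs).
apply: (main #|T| [:: r]); rewrite ?inE //; first by lia.
  split=> // [a b|a b c]; rewrite !inE => /eqP-> /eqP->.
    by exists [::].
  by rewrite /tri ei.
move=> x xp; exists r, [::], [::]; split=> //.
  apply/esym/eqP; rewrite cards_eq0; apply/eqP/setP => t; rewrite !inE.
  apply/negP => /andP[/istriP[a [b [c [h ->]]]] /subsetP st].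
  have [ab _ _] := tri_neq h.
  have := st a; have := st b; rewrite !inE !eqxx ?orbT => /(_ isT)/eqP bE /(_ isT)/eqP aE.
  by rewrite aE bE eqxx in ab.
right=> y; rewrite /qform !big_seq1 /dR dist0 //= /chain_form /= !addr0; ring.
Qed.

End Growth.

(** * Linear systems, and a Perron eigenvector for distance matrices *)

Lemma linear_system (F : fieldType) (T : finType) (B : T -> T -> F) :
  (exists2 h : T -> F, exists u, h u != 0 & forall u, \sum_v B u v * h v = 0) \/
  (forall c : T -> F, exists g : T -> F, forall u, \sum_v B u v * g v = c u).
Proof.
have re (G : T -> F) : \sum_u G u = \sum_(i < #|T|) G (enum_val i).
  by rewrite (reindex (@enum_val _ T)) //; apply: onW_bij; exists enum_rank;
    [exact: enum_valK | exact: enum_rankK].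
(* Transposed, since row vectors act from the left. *)
pose A : 'M[F]_#|T| := \matrix_(i, j) B (enum_val j) (enum_val i).
have mulA (v : 'rV[F]_#|T|) j : (v *m A) ord0 j = \sum_u B (enum_val j) u * v ord0 (enum_rank u).
  by rewrite !mxE re; apply: eq_bigr => i _; rewrite !mxE enum_valK mulrC.
case: (boolP (A \in unitmx)) => [uA|nA]; [right | left].
  move=> c; exists (fun u => ((\row_i c (enum_val i)) *m invmx A) ord0 (enum_rank u)) => u.
  by rewrite -[u in LHS]enum_rankK -mulA mulmxKV // mxE enum_rankK.
move: nA; rewrite -row_free_unit -kermx_eq0 => /rowV0Pn[v /sub_kermxP vA /eqP v0].
exists (fun u => v ord0 (enum_rank u)); last by move=> u; rewrite -[u]enum_rankK -mulA vA mxE.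
apply/existsP; apply: contraT => /existsPn h; case: v0; apply/rowP => i.
by have := h (enum_val i); rewrite negbK enum_valK mxE => /eqP.
Qed.

Lemma solve_linear (F : fieldType) (T : finType) (B : T -> T -> F) :
  (forall h : T -> F, (forall u, \sum_v B u v * h v = 0) -> forall u, h u = 0) ->
  forall c : T -> F, exists g : T -> F, forall u, \sum_v B u v * g v = c u.
Proof.
move=> inj; case: (linear_system B) => // -[h [u hu] /inj/(_ u) hu0].
by rewrite hu0 eqxx in hu.
Qed.

Section Spectral.
Variable R : realType.

(** A matrix-free top eigenvalue: the positive eigenvector of one graph is a test vector for the
    bound of another. *)
Definition spectral_radius (T : finType) (d : T -> T -> R) (r : R) : Prop :=
  (forall y, qform d (enum T) y <= r * \sum_u y u ^+ 2) /\
  exists2 x : T -> R, (forall u, 0 < x u) & forall u, \sum_v d u v * x v = r * x u.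

Lemma qform_enum (T : finType) (d : T -> T -> R) y :
  qform d (enum T) y = \sum_u \sum_v d u v * y u * y v.
Proof. by rewrite /qform big_enum; apply: eq_bigr => u _; rewrite big_enum. Qed.

Lemma qform_bounded (T : finType) (m : T -> T -> R) y :
  qform m (enum T) y <= (\sum_u \sum_v `|m u v|) * \sum_u y u ^+ 2.
Proof.
set S := \sum_u y u ^+ 2; rewrite qform_enum mulr_suml; apply: ler_sum => u _.
rewrite mulr_suml; apply: ler_sum => v _.
have le w : y w ^+ 2 <= S.
  by rewrite /S (bigD1 w) //= lerDl; apply: sumr_ge0 => t _; apply: sqr_ge0.
have yy : `|y u| * `|y v| <= S.
  have := sqr_ge0 (`|y u| - `|y v|); rewrite sqrrB !real_normK ?num_real //.
  by have := le u; have := le v; lra.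
apply: le_trans (ler_norm _) _; rewrite !normrM -mulrA.
by rewrite ler_wpM2l.
Qed.

Lemma cauchy_schwarz_bound (T : finType) (a : T -> R) :
  exists2 K, 0 < K & forall b : T -> R, (\sum_v a v * b v) ^+ 2 <= K * \sum_v b v ^+ 2.
Proof.
exists (\sum_u \sum_v `|a u * a v| + 1).
  by apply: ltr_wpDl => //; apply: sumr_ge0 => u _; apply: sumr_ge0.
move=> b; have -> : (\sum_v a v * b v) ^+ 2 = qform (fun u v => a u * a v) (enum T) b.
  rewrite qform_enum expr2 mulr_suml; apply: eq_bigr => u _; rewrite mulr_sumr.
  by apply: eq_bigr => v _; ring.
apply: le_trans (qform_bounded _ _) _; rewrite mulrDl mul1r lerDl.
by apply: sumr_ge0 => v _; apply: sqr_ge0.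
Qed.

Lemma quadratic_ge0 (a b c : R) : 0 < c -> (forall t, 0 <= a + 2 * t * b + t ^+ 2 * c) ->
  b ^+ 2 <= a * c.
Proof.
move=> c0 /(_ (- b / c)); rewrite (_ : _ + _ = (a * c - b ^+ 2) / c); last by field; rewrite gt_eqF.
by rewrite pmulr_lge0 ?invr_gt0 // subr_ge0.
Qed.

(* Cauchy-Schwarz for the form [B] bounds [|B y|^2] by a multiple of the form at [y], and
   invertibility bounds [|y|^2] by a multiple of [|B y|^2]. *)
Lemma coercive (T : finType) (B : T -> T -> R) : (forall u v, B u v = B v u) ->
  (forall y, 0 <= qform B (enum T) y) ->
  (forall c : T -> R, exists g : T -> R, forall u, \sum_v B u v * g v = c u) ->
  exists2 K, 0 < K & forall y, \sum_u y u ^+ 2 <= K * qform B (enum T) y.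
Proof.
move=> Bs B0 sol; pose By y u := \sum_v B u v * y v.
have qE y z t : qform B (enum T) (fun u => y u + t * z u) =
    qform B (enum T) y + 2 * t * (\sum_u z u * By y u) + t ^+ 2 * qform B (enum T) z.
  have ex (f h : T -> R) : \sum_u f u * By h u = \sum_u \sum_v B u v * f u * h v.
    by apply: eq_bigr => u _; rewrite mulr_sumr; apply: eq_bigr => v _; ring.
  have sy : \sum_u y u * By z u = \sum_u z u * By y u.
    rewrite !ex exchange_big; apply: eq_bigr => u _; apply: eq_bigr => v _.
    by rewrite Bs; ring.
  rewrite (_ : 2 * t * _ = t * (\sum_u y u * By z u) + t * (\sum_u z u * By y u)); last first.
    by rewrite sy; ring.
  rewrite !qform_enum !ex !mulr_sumr -!big_split /=; apply: eq_bigr => u _.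
  by rewrite !mulr_sumr -!big_split /=; apply: eq_bigr => v _; ring.
pose KB := \sum_u \sum_v `|B u v| + 1.
have KB0 : 0 < KB by apply: ltr_wpDl => //; apply: sumr_ge0 => u _; apply: sumr_ge0.
have By2 y : \sum_u By y u ^+ 2 <= KB * qform B (enum T) y.
  set N := \sum_u _; have N0 : 0 <= N by apply: sumr_ge0 => u _; apply: sqr_ge0.
  move: (N0); rewrite le_eqVlt => /orP[/eqP<-|Npos]; first by rewrite mulr_ge0 // ltW.
  have := @quadratic_ge0 (qform B (enum T) y) N (KB * N) (mulr_gt0 KB0 Npos) _.
  rewrite expr2 mulrA ler_pM2r // => H; rewrite mulrC; apply: H => t.
  (* Nonnegativity of the form along [y + t By], where the coefficient of [2t] is [|By|^2]. *)
  apply: le_trans (B0 (fun u => y u + t * By y u)) _; rewrite qE lerD2l.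
    apply: ler_wpM2l; first exact: sqr_ge0.
    apply: le_trans (qform_bounded _ _) _; rewrite mulrDl mul1r lerDl //.
have [K K0 KP] : exists2 K, 0 < K & forall y, \sum_u y u ^+ 2 <= K * \sum_u By y u ^+ 2.
  have coord w : exists2 K, 0 < K & forall y, y w ^+ 2 <= K * \sum_u By y u ^+ 2.
    (* With [B g] the indicator of [w], the coordinate [y w] is the pairing of [g] with [B y]. *)
    have [g gE] := sol (fun u => (u == w)%:R).
    have [K K0 KP] := cauchy_schwarz_bound g; exists K => // y.
    rewrite -[y w](_ : \sum_v g v * By y v = _) //.
    have -> : y w = \sum_u (\sum_v B u v * g v) * y u.
      rewrite (bigD1 w) //= gE eqxx mul1r big1 ?addr0 // => u uw.
      by rewrite gE (negPf uw) mul0r.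
    under [RHS]eq_bigr do rewrite mulr_suml.
    rewrite exchange_big; apply: eq_bigr => v _; rewrite /By mulr_sumr; apply: eq_bigr => u _.
    by rewrite Bs; ring.
  have [K0 KP] : exists K0 : T -> R, forall w, 0 < K0 w /\ forall y, y w ^+ 2 <= K0 w * \sum_u By y u ^+ 2.
    have co w : exists k, 0 < k /\ forall y, y w ^+ 2 <= k * \sum_u By y u ^+ 2.
      by have [k k0 kP] := coord w; exists k.
    by exists (fun w => projT1 (boolp.cid (co w))) => w; case: boolp.cid.
  exists (\sum_w K0 w + 1).
    by apply: ltr_wpDl => //; apply: sumr_ge0 => w _; apply/ltW; case: (KP w).
  move=> y; rewrite mulrDl mul1r mulr_suml; apply: ler_wpDr.
    by apply: sumr_ge0 => u _; apply: sqr_ge0.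
  by apply: ler_sum => w _; case: (KP w).
exists (K * KB); first exact: mulr_gt0.
by move=> y; apply: le_trans (KP y) _; rewrite -mulrA ler_pM2l.
Qed.

(* With [r] the least bound of the Rayleigh quotients, [r - d] is positive semidefinite, and it is
   singular, for otherwise it is coercive and [r] can be lowered. *)
Lemma top_eigenvector (T : finType) (d : T -> T -> R) : (0 < #|T|)%N ->
  (forall u v, d u v = d v u) -> (forall u, d u u = 0) ->
  exists r, (forall y, qform d (enum T) y <= r * \sum_u y u ^+ 2) /\
    exists2 x : T -> R, exists u, x u != 0 & forall u, \sum_v d u v * x v = r * x u.
Proof.
move=> /card_gt0P[u0 _] dsym d0.
pose E (t : R) := forall y, qform d (enum T) y <= t * \sum_u y u ^+ 2.
have E0 : classical_sets.nonempty E by exists (\sum_u \sum_v `|d u v|) => y; apply: qform_bounded.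
have lbE (y : T -> R) : 0 < \sum_u y u ^+ 2 ->
    classical_sets.lbound E (qform d (enum T) y / \sum_u y u ^+ 2).
  by move=> y0 t Et; rewrite ler_pdivrMr.
have pos (y : T -> R) : \sum_u y u ^+ 2 = 0 \/ 0 < \sum_u y u ^+ 2.
  have : 0 <= \sum_u y u ^+ 2 by apply: sumr_ge0 => u _; apply: sqr_ge0.
  by rewrite le_eqVlt => /orP[/eqP<-|]; [left | right].
have hlb : classical_sets.has_lbound E.
  exists (qform d (enum T) (fun=> 1) / \sum_(u : T) 1 ^+ 2); apply: (lbE (fun=> 1)).
  by rewrite (bigD1 u0) //= ltr_pwDl ?expr1n //; apply: sumr_ge0 => u _; rewrite ?expr1n ler01.
pose r := inf E; exists r.
have bound : E r.
  move=> y; case: (pos y) => [s0|s0]; last by rewrite -ler_pdivrMr //; apply: lb_le_inf => //; apply: lbE.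
  by have := qform_bounded d y; rewrite s0 !mulr0.
split=> //.
pose B u v := r * (u == v)%:R - d u v.
have Bsum u y : \sum_v B u v * y v = r * y u - \sum_v d u v * y v.
  have <- : \sum_v (u == v)%:R * y v = y u.
    rewrite (bigD1 u) //= eqxx mul1r big1 ?addr0 // => v vu.
    by rewrite eq_sym (negPf vu) mul0r.
  by rewrite mulr_sumr -sumrB; apply: eq_bigr => v _; rewrite /B; ring.
have qB y : qform B (enum T) y = r * (\sum_u y u ^+ 2) - qform d (enum T) y.
  rewrite !qform_enum mulr_sumr -sumrB; apply: eq_bigr => u _.
  have -> : \sum_v B u v * y u * y v = y u * \sum_v B u v * y v.
    by rewrite mulr_sumr; apply: eq_bigr => v _; ring.
  rewrite Bsum mulrBr mulr_sumr; congr (_ - _); first by ring.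
  by apply: eq_bigr => v _; ring.
case: (linear_system B) => [[x x0 xB]|sol].
  by exists x => // u; have /eqP := xB u; rewrite Bsum subr_eq0 => /eqP.
have [||K K0 KP] := coercive _ _ sol.
- by move=> u v; rewrite /B eq_sym dsym.
- by move=> y; rewrite qB subr_ge0.
suff : E (r - K^-1) by move/(ge_inf hlb); rewrite -/r lerBrDr gerDl leNgt invr_gt0 K0.
move=> y; have := KP y; rewrite qB mulrC -ler_pdivrMr // mulrBl [K^-1 * _]mulrC.
by lra.
Qed.

Lemma linear_coef_eq0 (b c : R) : (forall t, 0 <= 2 * t * b + t ^+ 2 * c) -> b = 0.
Proof.
move=> h; apply/eqP; apply: contraT => b0.
have C0 : 0 < `|c| + 1 by have := normr_ge0 c; lra.
have cC : c < `|c| + 1 by have := ler_norm c; lra.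
have := h (- b / (`|c| + 1)).
rewrite (_ : _ + _ = - (b ^+ 2 / (`|c| + 1)) * (2 - c / (`|c| + 1))); last first.
  by field; rewrite gt_eqF.
rewrite mulNr oppr_ge0 leNgt => /negP[]; apply: mulr_gt0.
  by rewrite divr_gt0 // exprn_even_gt0.
by rewrite subr_gt0 ltr_pdivrMr //; lra.
Qed.

Lemma qform_eigen (T : finType) (d : T -> T -> R) r (x : T -> R) :
  (forall u, \sum_v d u v * x v = r * x u) -> qform d (enum T) x = r * \sum_u x u ^+ 2.
Proof.
move=> ev; rewrite qform_enum mulr_sumr; apply: eq_bigr => u _.
rewrite (eq_bigr (fun v => x u * (d u v * x v))); last by move=> v _; ring.
by rewrite -mulr_sumr ev; ring.
Qed.

Section Exists.
Variables (T : finType) (d : T -> T -> R).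
Hypotheses (dsym : forall u v, d u v = d v u) (d0 : forall u, d u u = 0).
Hypothesis dpos : forall u v, u != v -> 0 < d u v.
Hypothesis T1 : (1 < #|T|)%N.

Let dge0 u v : 0 <= d u v.
Proof. by case: (eqVneq u v) => [->|/dpos/ltW //]; rewrite d0. Qed.

(** As [d] is nonnegative, the absolute values of a top eigenvector still attain the bound, and the
    first-order condition makes them an eigenvector. A zero coordinate would force all others to
    vanish, by positivity off the diagonal. *)
Lemma spectral_radius_exists : exists r, spectral_radius d r.
Proof.
have [r [bound [c [u0 cu0] ec]]] := top_eigenvector (ltnW T1) dsym d0.
pose x u := `|c u|.
have rx : qform d (enum T) x = r * \sum_u x u ^+ 2.
  apply/eqP; rewrite eq_le bound /=.
  have -> : \sum_u x u ^+ 2 = \sum_u c u ^+ 2 by apply: eq_bigr => u _; rewrite real_normK ?num_real.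
  rewrite -(qform_eigen ec) !qform_enum; apply: ler_sum => u _; apply: ler_sum => v _.
  by apply: le_trans (ler_norm _) _; rewrite !normrM (ger0_norm (dge0 _ _)).
have ev u : \sum_v d u v * x v = r * x u.
  apply/eqP; rewrite eq_sym -subr_eq0; apply/eqP; apply: (@linear_coef_eq0 _ r) => t.
  have := bound (bump x u t).
  rewrite qform_bump ?enum_uniq ?mem_enum // rx big_enum /=.
  have -> : \sum_w bump x u t w ^+ 2 = \sum_w x w ^+ 2 + 2 * t * x u + t ^+ 2.
    rewrite (bigD1 u) //= [in RHS](bigD1 u) //= bump_in.
    rewrite (eq_bigr (fun w => x w ^+ 2)); last by move=> w wu; rewrite bump_out.
    by ring.
  by lra.
exists r; split=> //; exists x => // u.
rewrite lt_def normr_ge0 andbT; apply/negP => /eqP xu0.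
have xall v : x v = 0.
  case: (eqVneq v u) => [->//|vu].
  have s0 : \sum_w d u w * x w = 0 by rewrite ev xu0 mulr0.
  have /eqP := psumr_eq0P (fun w _ => mulr_ge0 (dge0 u w) (normr_ge0 (c w))) s0 (i := v) isT.
  by rewrite mulf_eq0 gt_eqF ?dpos ?(eq_sym u) //= => /eqP.
by move/eqP: (xall u0); rewrite normr_eq0 (negPf cu0).
Qed.

End Exists.

Lemma sum_sqr_gt0 (T : finType) (x : T -> R) : (0 < #|T|)%N -> (forall u, 0 < x u) ->
  0 < \sum_u x u ^+ 2.
Proof.
move=> /card_gt0P[u _] xp; rewrite (bigD1 u) //=.
apply: ltr_wpDr; last by rewrite exprn_gt0.
by apply: sumr_ge0 => v _; apply: sqr_ge0.
Qed.

Lemma qform_reindex (T T' : finType) (f : T -> T') (d : T -> T -> R) (d' : T' -> T' -> R) y :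
  bijective f -> (forall u v, d' (f u) (f v) = d u v) ->
  qform d (enum T) (y \o f) = qform d' (enum T') y.
Proof.
move=> bf E; rewrite !qform_enum [RHS](reindex f) /=; last exact: onW_bij.
apply: eq_bigr => u _; rewrite [RHS](reindex f) /=; last exact: onW_bij.
by apply: eq_bigr => v _; rewrite E.
Qed.

Lemma spectral_radius_le (T T' : finType) (f : T -> T') (d : T -> T -> R) (d' : T' -> T' -> R) r r' :
  (0 < #|T|)%N -> bijective f -> (forall u v, d' (f u) (f v) = d u v) ->
  spectral_radius d r -> spectral_radius d' r' -> r <= r'.
Proof.
move=> T0 bf E [_ [x xp ev]] [bd _]; have [g fg gf] := bf.
have := bd (x \o g).
have -> : \sum_u (x \o g) u ^+ 2 = \sum_u x u ^+ 2.
  by rewrite (reindex f) /=; [apply: eq_bigr => u _; rewrite fg | exact: onW_bij].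
rewrite -(qform_reindex (x \o g) bf E) (@eq_qform _ _ _ _ _ x); last by move=> u _; rewrite /= fg.
by rewrite (qform_eigen ev) ler_pM2r // sum_sqr_gt0.
Qed.

(** The value [r'] with a positive eigenvector is an eigenvalue, so [r' <= r]; an eigenvector of [r]
    tested in the bound of [r'] gives the converse. *)
Lemma largest_eig_radius (T : finType) (e : rel T) r : (1 < #|T|)%N ->
  simple_graph e -> connected_graph e -> largest_eig (dist_mx R e) r ->
  spectral_radius (dR e R) r.
Proof.
move=> T1 [es ei] conn [/eigenvalueP[v vE v0] rmax].
have dsym u w : dR e R u w = dR e R w u by rewrite /dR dist_sym.
have [||r' [bd [x xp ev]]] := spectral_radius_exists dsym _ _ T1.
- by move=> u; rewrite /dR dist0.
- move=> u w uw; rewrite /dR ltr0n lt0n; apply: contra uw => /eqP/(dist_eq0 conn)->.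
  by rewrite eqxx.
have re (F : T -> R) : \sum_u F u = \sum_(i < #|T|) F (enum_val i).
  by rewrite (reindex (@enum_val _ T)) //; apply: onW_bij; exists enum_rank;
    [exact: enum_valK | exact: enum_rankK].
suff -> : r = r' by split=> //; exists x.
apply/eqP; rewrite eq_le; apply/andP; split; last first.
  apply: rmax; apply/eigenvalueP; exists (\row_i x (enum_val i)).
    apply/rowP => j; rewrite !mxE -ev re; apply: eq_bigr => i _.
    by rewrite !mxE mulrC dsym.
  have /card_gt0P[u _] := ltnW T1.
  apply/eqP => /rowP/(_ (enum_rank u)); rewrite !mxE enum_rankK => /eqP.
  by rewrite gt_eqF.
pose y u := v ord0 (enum_rank u).
have yev u : \sum_w dR e R u w * y w = r * y u.
  move/rowP: vE => /(_ (enum_rank u)); rewrite !mxE => <-.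
  rewrite re; apply: eq_bigr => i _; rewrite !mxE /y enum_valK enum_rankK mulrC dsym.
  by [].
have := bd y; rewrite (qform_eigen yev) ler_pM2r //.
rewrite lt_def sumr_ge0 ?andbT; last by move=> u _; apply: sqr_ge0.
apply: contra v0 => /eqP s0; apply/eqP/rowP => i; rewrite mxE.
have /eqP := psumr_eq0P (fun w _ => sqr_ge0 (y w)) s0 (i := enum_val i) isT.
by rewrite sqrf_eq0 /y enum_valK => /eqP.
Qed.

End Spectral.

(** * Moving one triangle from the longer run to the shorter one *)

Section Balance.
Variables (R : realFieldType) (T : finType) (p q l : nat) (pi : T -> nat).
Hypotheses (sh : shape p q l pi) (l1 : (1 <= l)%N) (pq : (p + 2 <= q)%N).
Variables (r : R) (x : T -> R).
Let d := dpi R pi.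
Hypotheses (xp : forall u, 0 < x u) (xev : forall u, \sum_v d u v * x v = r * x u).
Variable w0 : T.
(** [R0] is the first apex position of the right run, [L0] the first free one after the left run,
    and [L0 + R0 = M]. The reflection [s -> M - s] matches the [p] triangles on the left with the
    [p] ones following [w0]; [p + 2 <= q] puts the end of the path beyond [M]. *)
Let R0 := (2 * (p + l)).+1.
Let L0 := (2 * p).+1.
Let M := (2 * (2 * p + l + 1))%N.
Hypothesis pw0 : pi w0 = R0.

(* The innermost triangle of the right-hand run is moved to the left-hand one; [M / 2] is the
   middle of the path which links the remaining triangles. *)
Definition moved (u : T) : nat := if u == w0 then L0 else pi u.
Let d' := dpi R moved.

Lemma moved_shape : shape p.+1 q.-1 l moved.
Proof.
have nL u : pi u != L0.
  apply/eqP => E; have /sh.2 : exists v, pi v = L0 by exists u.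
  by rewrite /posok /L0; lia.
split=> [u v|s]; rewrite /moved.
  by do ! case: eqP => [->|_] //; [move=> E; have := nL v; rewrite -E eqxx
    | move=> E; have := nL u; rewrite E eqxx | move/sh.1].
split=> [[u]|ok].
  case: eqP => [_ <-|uw0 us]; first by rewrite /posok /L0; lia.
  have /sh.2 : exists v, pi v = s by exists u.
  have : s != R0 by apply/eqP => E; apply: uw0; apply: sh.1; rewrite us pw0.
  by rewrite /posok /R0; lia.
case: (eqVneq s L0) => [->|sL]; first by exists w0; rewrite eqxx.
have /sh.2[u us] : posok p q l s by move: ok sL; rewrite /posok /L0; lia.
exists u; case: eqP => [uw0|//].
by move: us ok; rewrite uw0 pw0 => <-; rewrite /posok /R0; lia.
Qed.

Let dge0 u v : 0 <= d u v. Proof. exact: dpi_ge0. Qed.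
Let d_gt0 u v : u != v -> 0 < d u v. Proof. by apply: dpi_gt0 sh.1. Qed.

Let K (u : T) := (u != w0) && (pi u <= M)%N.
Let c (u : T) : R := d u w0 - d' u w0.

Definition absd (a b : nat) : R := (a - b + (b - a))%N%:R.
Definition podd (a : nat) : R := (odd a)%:R.

Lemma dposE a b : dpos R a b = (absd a b + podd a + podd b) / 2.
Proof. by rewrite /dpos /absd /podd !natrD. Qed.

Lemma absd_ge a b : (b <= a)%N -> absd a b = a%:R - b%:R.
Proof. by move=> ab; rewrite /absd -natrB //; congr (_%:R); lia. Qed.

Lemma absd_le a b : (a <= b)%N -> absd a b = b%:R - a%:R.
Proof. by move=> ab; rewrite /absd -natrB //; congr (_%:R); lia. Qed.

(** Up to the factor 2, [absd] is the fundamental solution of the second difference, which turns the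
    system for [g] into a recurrence along positions. *)
Lemma absd_diff2 s a : absd s.+2 a - 2 * absd s.+1 a + absd s a = 2 * (s.+1 == a)%:R.
Proof.
case: (ltngtP a s.+1) => as1.
- rewrite !absd_ge; [|lia|lia|lia].
  by rewrite -[s.+2%:R]natr1 -[s.+1%:R]natr1 /= mulr0; ring.
- rewrite !absd_le; [|lia|lia|lia].
  by rewrite -[s.+2%:R]natr1 -[s.+1%:R]natr1 /= mulr0; ring.
- rewrite as1 (@absd_ge s.+2) // absd_ge // (absd_le (leqnSn s)).
  by rewrite -[s.+2%:R]natr1 -[s.+1%:R]natr1 /=; ring.
Qed.

Lemma r_gt0 : 0 < r.
Proof.
have /sh.2[v pv] : posok p q l 0 by rewrite /posok; lia.
have vw : v != w0 by apply: contraTneq isT => E; move: pv; rewrite E pw0 /R0.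
rewrite -(pmulr_lgt0 _ (xp w0)) -xev (bigD1 v) //=.
apply: ltr_wpDr; last by rewrite mulr_gt0 // d_gt0 // eq_sym.
by apply: sumr_ge0 => u _; rewrite mulr_ge0 ?dge0 // ltW.
Qed.

Lemma dsum_sym (h : T -> R) : \sum_u x u * (\sum_v d u v * h v) = r * \sum_u x u * h u.
Proof.
have -> : \sum_u x u * (\sum_v d u v * h v) = \sum_v (\sum_u d v u * x u) * h v.
  rewrite (eq_bigr (fun u => \sum_v x u * (d u v * h v))); last by move=> u _; rewrite mulr_sumr.
  rewrite exchange_big; apply: eq_bigr => v _; rewrite mulr_suml; apply: eq_bigr => u _.
  by rewrite /d dpi_sym; ring.
by rewrite mulr_sumr; apply: eq_bigr => v _; rewrite xev mulrA.
Qed.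

(** [r] is not an eigenvalue of the principal submatrix on [K]: [D|h| - r|h|] has no negative entry
    and is orthogonal to [x], so it vanishes. At [w0], where [h] is zero, this says [D|h| = 0], and
    the rest of that row of [D] is positive. *)
Lemma kernel_trivial (h : T -> R) : (forall u, ~~ K u -> h u = 0) ->
  (forall u, K u -> \sum_v d u v * h v = r * h u) -> forall u, h u = 0.
Proof.
move=> h0 hK; pose a u := `|h u|.
have s0 : \sum_u (x u * (\sum_v d u v * a v) - r * (x u * a u)) = 0.
  by rewrite sumrB dsum_sym mulr_sumr subrr.
have sge u : 0 <= \sum_v d u v * a v.
  by apply: sumr_ge0 => v _; rewrite mulr_ge0 ?dge0 ?normr_ge0.
have tge u : true -> 0 <= x u * (\sum_v d u v * a v) - r * (x u * a u).
  move=> _; rewrite mulrCA -mulrBr; apply: mulr_ge0; first exact: ltW.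
  case: (boolP (K u)) => [Ku|/h0 hu]; last by rewrite /a hu normr0 mulr0 subr0.
  rewrite subr_ge0 -[r](ger0_norm (ltW r_gt0)) -normrM -hK //.
  apply: le_trans (ler_norm_sum _ _ _) _; apply: ler_sum => v _.
  by rewrite normrM (ger0_norm (dge0 _ _)).
have := psumr_eq0P tge s0 (i := w0) isT.
have aw0 : a w0 = 0 by rewrite /a h0 ?normr0 // /K eqxx.
rewrite aw0 !mulr0 subr0 => /eqP; rewrite mulf_eq0 gt_eqF //= => /eqP s1 u.
case: (eqVneq u w0) => [->|uw]; first by rewrite h0 // /K eqxx.
have := psumr_eq0P (fun v _ => mulr_ge0 (dge0 w0 v) (normr_ge0 (h v))) s1 (i := u) isT.
by move/eqP; rewrite mulf_eq0 gt_eqF ?d_gt0 ?(eq_sym w0) //= normr_eq0 => /eqP.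
Qed.

Lemma response_exists : exists2 g : T -> R, (forall u, ~~ K u -> g u = 0) &
  forall u, K u -> \sum_v d u v * g v = r * g u - c u.
Proof.
(* Identity rows off [K] force the solution to vanish there, so the system on [K] becomes a square
   one on [T]. *)
pose B u v : R := if K u && K v then r * (u == v)%:R - d u v else (u == v)%:R.
have deltas u (h : T -> R) : \sum_v (u == v)%:R * h v = h u.
  rewrite (bigD1 u) //= eqxx mul1r big1 ?addr0 // => v vu.
  by rewrite eq_sym (negPf vu) mul0r.
have Bout u h : ~~ K u -> \sum_v B u v * h v = h u.
  by move=> Ku; rewrite -[RHS]deltas; apply: eq_bigr => v _; rewrite /B (negPf Ku).
have Bin u (h : T -> R) : (forall v, ~~ K v -> h v = 0) -> K u ->
    \sum_v B u v * h v = r * h u - \sum_v d u v * h v.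
  move=> h0 Ku; rewrite -[h u in RHS]deltas mulr_sumr -sumrB; apply: eq_bigr => v _.
  by rewrite /B Ku /=; case: (boolP (K v)) => [_|/h0->]; [ring | rewrite !mulr0 subr0].
have [|g gE] := @solve_linear _ _ B _ (fun u => if K u then c u else 0).
  move=> h hB; have h0 u : ~~ K u -> h u = 0 by move=> Ku; rewrite -(Bout u) // hB.
  by apply: kernel_trivial => // u Ku; have := hB u; rewrite Bin // => /eqP; rewrite subr_eq0 => /eqP.
have g0 u : ~~ K u -> g u = 0 by move=> Ku; rewrite -(Bout u) // gE (negPf Ku).
by exists g => // u Ku; have := gE u; rewrite Bin // Ku => <-; ring.
Qed.

(* The reflection of [K] about position [M / 2]. *)
Definition flip (u : T) : T :=
  if K u then odflt u [pick v | pi v == M - pi u]%N else u.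

Lemma flipP u : K u -> K (flip u) /\ pi (flip u) = (M - pi u)%N.
Proof.
move=> Ku; rewrite /flip Ku; move: Ku => /andP[uw uM].
have ok : posok p q l (pi u) by apply/sh.2; exists u.
have nR : pi u != R0 by apply: contraNneq uw => E; apply/eqP/sh.1; rewrite E pw0.
have nL : pi u != L0.
  by apply/eqP => E; move: ok; rewrite E /posok /L0; lia.
have /sh.2[v pv] : posok p q l (M - pi u).
  by move: ok nR nL uM; rewrite /posok /R0 /L0 /M; lia.
case: pickP => [t /eqP pt|/(_ v)]; last by rewrite pv eqxx.
split=> //=; rewrite /K pt; apply/andP; split; last by lia.
apply: contraNneq nL => tw; apply/eqP; move: pt; rewrite tw pw0 /R0 /L0.
by move: uM; rewrite /M; lia.
Qed.

Lemma flip_out u : ~~ K u -> flip u = u.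
Proof. by rewrite /flip => /negPf->. Qed.

Lemma flipK : involutive flip.
Proof.
move=> u; case: (boolP (K u)) => Ku; last by rewrite !flip_out.
have [K1 E1] := flipP Ku; have [K2 E2] := flipP K1.
by apply: sh.1; rewrite E2 E1; have /andP[_] := Ku; lia.
Qed.

Lemma d_flip u v : K u -> K v -> d (flip u) (flip v) = d u v.
Proof.
move=> Ku Kv; have [_ E1] := flipP Ku; have [_ E2] := flipP Kv.
rewrite /d /dpi (inj_eq (inv_inj flipK)) E1 E2; case: eqP => // _.
have /andP[_ uM] := Ku; have /andP[_ vM] := Kv.
exact: dpos_mirror.
Qed.

Lemma d'w0 u : u != w0 -> d' u w0 = dpos R (pi u) L0.
Proof. by move=> uw; rewrite /d' /dpi (negPf uw) /moved (negPf uw) eqxx. Qed.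

Lemma dw0 u : u != w0 -> d u w0 = dpos R (pi u) R0.
Proof. by move=> uw; rewrite /d /dpi (negPf uw) pw0. Qed.

Lemma dw0_flip u : K u -> d (flip u) w0 = d' u w0.
Proof.
move=> Ku; have [/andP[fw _] E] := flipP Ku; have /andP[uw uM] := Ku.
rewrite dw0 // d'w0 // E (_ : R0 = M - L0)%N; last by rewrite /M /R0 /L0; clear; lia.
by apply: dpos_mirror; rewrite // /L0; clear; lia.
Qed.

Lemma c_flip u : K u -> c (flip u) = - c u.
Proof.
move=> Ku; have [Kf _] := flipP Ku; rewrite /c dw0_flip //.
by rewrite -(dw0_flip Kf) flipK; ring.
Qed.

Section Response.
Variable g : T -> R.
Hypotheses (g0 : forall u, ~~ K u -> g u = 0)
  (gK : forall u, K u -> \sum_v d u v * g v = r * g u - c u).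

(** The sum of [g] and its reflection solves the homogeneous system on [K], because [c] changes
    sign. *)
Lemma g_flip u : g (flip u) = - g u.
Proof.
apply/eqP; rewrite -addr_eq0 addrC; apply/eqP; move: u.
apply: (@kernel_trivial (fun u => g u + g (flip u))) => [u Ku|u Ku].
  by rewrite flip_out // g0 // addr0.
have -> : \sum_v d u v * (g v + g (flip v)) = \sum_v d u v * g v + \sum_v d (flip u) v * g v.
  rewrite -big_split /= [in RHS]big_split /= [X in _ = _ + X](reindex_inj (inv_inj flipK)) /= -big_split /=.
  apply: eq_bigr => v _; rewrite mulrDr; congr (_ + _).
  case: (boolP (K v)) => [Kv|Kv]; first by rewrite d_flip.
  by rewrite flip_out // g0 // !mulr0.
have [Kf _] := flipP Ku.
by rewrite !gK // c_flip //; ring.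
Qed.

Lemma odd_sum (F : T -> R) : (forall u, K u -> F (flip u) = F u) -> \sum_v F v * g v = 0.
Proof.
move=> FK; set S := \sum_v _; suff : S = - S by lra.
rewrite {1}/S (reindex_inj (inv_inj flipK)) /= -sumrN; apply: eq_bigr => v _.
rewrite g_flip; case: (boolP (K v)) => [/FK->|/g0->]; ring.
Qed.

Lemma sum_g : \sum_v g v = 0.
Proof. by rewrite -[RHS](@odd_sum (fun=> 1)) //; apply: eq_bigr => v _; rewrite mul1r. Qed.

(* Extends [(r - D_K) g = c] to all positions: [potential] is [(r + 1) g] at an apex of [K] and
   [r g] at a path vertex, and its second difference at [s] is the value of [g] there, corrected
   by [-1] at [L0] and [+1] at [R0]. *)
Definition potential (s : nat) : R :=
  (absd s R0 - absd s L0) / 2 + (\sum_v absd s (pi v) * g v) / 2.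

(** The parity terms cancel in the sum because [g] is antisymmetric and the reflection preserves
    parity. Only the diagonal leaves a trace: there the formula reads [podd], the distance 0. *)
Lemma potentialE u : K u -> (r + podd (pi u)) * g u = potential (pi u).
Proof.
move=> Ku; have /andP[uw _] := Ku; have := gK Ku.
have -> : \sum_v d u v * g v = (\sum_v absd (pi u) (pi v) * g v) / 2 - podd (pi u) * g u.
  have -> : (\sum_v absd (pi u) (pi v) * g v) / 2 =
     \sum_v ((absd (pi u) (pi v) + podd (pi u) + podd (pi v)) / 2 * g v).
    rewrite [RHS](eq_bigr (fun v => absd (pi u) (pi v) * g v / 2 + podd (pi u) / 2 * g v
       + podd (pi v) / 2 * g v)); last by move=> v _; ring.
    rewrite !big_split /= -mulr_suml -mulr_sumr sum_g (@odd_sum (fun v => podd (pi v) / 2)).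
      by ring.
    move=> v Kv; have [_ ->] := flipP Kv; have /andP[_] := Kv.
    by rewrite /podd /M => vM; congr ((nat_of_bool _)%:R / _); lia.
  rewrite (bigD1 u) //= [in RHS](bigD1 u) //= /d dpi0 mul0r add0r.
  rewrite (eq_bigr (fun v => (absd (pi u) (pi v) + podd (pi u) + podd (pi v)) / 2 * g v)).
    by rewrite /absd !subnn mulr0n; field.
  by move=> v vu; rewrite /dpi eq_sym (negPf vu) dposE.
rewrite /c dw0 // d'w0 // !dposE /potential => h.
rewrite mulrDl (_ : r * g u = (\sum_v absd (pi u) (pi v) * g v) / 2 - podd (pi u) * g u
 + ((absd (pi u) R0 + podd (pi u) + podd R0) / 2 - (absd (pi u) L0 + podd (pi u) + podd L0) / 2)); last first.
  by rewrite h; ring.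
have -> : podd R0 = podd L0 by rewrite /podd /R0 /L0; congr ((nat_of_bool _)%:R); lia.
by field.
Qed.

Lemma potential_mid : potential (2 * p + l + 1) = 0.
Proof.
rewrite /potential (@odd_sum (fun v => absd (2 * p + l + 1) (pi v))); last first.
  move=> v Kv; have [_ ->] := flipP Kv; have /andP[_] := Kv.
  by rewrite /absd /M => vM; congr (_%:R); lia.
rewrite /absd (_ : (_ + _ : nat)%N = l); last by rewrite /R0; lia.
by rewrite (_ : (_ - L0 + _ : nat)%N = l); [ring | rewrite /L0; lia].
Qed.

Lemma potential_diff2 s : potential s.+2 - potential s.+1 = potential s.+1 - potential s
  + (s.+1 == R0)%:R - (s.+1 == L0)%:R + \sum_(v | pi v == s.+1) g v.
Proof.
have -> : \sum_(v | pi v == s.+1) g v = (\sum_v absd s.+2 (pi v) * g v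
   - 2 * (\sum_v absd s.+1 (pi v) * g v) + \sum_v absd s (pi v) * g v) / 2.
  rewrite mulr_sumr -sumrB -big_split /= mulr_suml big_mkcond; apply: eq_bigr => v _ /=.
  have -> : absd s.+2 (pi v) * g v - 2 * (absd s.+1 (pi v) * g v) + absd s (pi v) * g v =
    (absd s.+2 (pi v) - 2 * absd s.+1 (pi v) + absd s (pi v)) * g v by ring.
  by rewrite absd_diff2 eq_sym; case: eqP => _ /=; field.
have := absd_diff2 s R0; have := absd_diff2 s L0; rewrite /potential.
by lra.
Qed.

(* If [potential 0 <= 0], it stays nonpositive and nonincreasing up to the middle, decreasing
   strictly past [L0], against [potential_mid]. *)
Lemma potential0_gt0 : 0 < potential 0.
Proof.
rewrite ltNge; apply/negP => P0.
have rp := r_gt0.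
have gle s u : potential s <= 0 -> pi u = s -> g u <= 0.
  move=> Ps us; case: (boolP (K u)) => [Ku|/g0-> //].
  have := potentialE Ku; rewrite us => E; rewrite -E in Ps.
  by rewrite -(pmulr_rle0 _ (_ : 0 < r + podd s)) // ltr_wpDr // /podd ler0n.
have main s : (s < 2 * p + l + 1)%N ->
    potential s <= 0 /\ potential s.+1 - potential s <= - (L0 <= s)%N%:R.
  elim: s => [|s IH] sh1.
    split=> //; rewrite leqn0 /= oppr0.
    have /sh.2[v pv] : posok p q l 0 by rewrite /posok; lia.
    (* Since [g] has sum zero, only its value at position 0 enters the first difference. *)
    suff -> : potential 1 - potential 0 = g v by apply: (gle 0%N).
    rewrite /potential.
    have a0 a : (0 < a)%N -> absd 1 a = absd 0 a - 1.
      by move=> ap; rewrite !absd_le // mulr0n mulr1n subr0.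
    rewrite (a0 R0) // (a0 L0) //.
    have -> : \sum_v absd 1 (pi v) * g v = \sum_v absd 0 (pi v) * g v + 2 * g v.
      have -> : 2 * g v = \sum_u (2 * (u == v)%:R) * g u - \sum_u g u.
        rewrite sum_g subr0 (bigD1 v) //= eqxx big1 ?addr0 ?mulr1 // => u uv.
        by rewrite (negPf uv) mulr0 mul0r.
      rewrite -sumrB -big_split /=; apply: eq_bigr => u _.
      have -> : (u == v) = (pi u == 0%N) by rewrite -pv (inj_eq sh.1).
      case: (posnP (pi u)) => [->|up]; first by rewrite (_ : absd 1 0 = 1) // (_ : absd 0 0 = 0) // /=; ring.
      by rewrite a0 //=; ring.
    by field.
  have [Ps Ds] := IH (ltnW sh1).
  have Ps1 : potential s.+1 <= 0.
    by have : 0 <= (L0 <= s)%N%:R :> R by []; lra.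
  split=> //; rewrite potential_diff2.
  have -> : (s.+1 == R0) = false by rewrite /R0; lia.
  have gs : \sum_(v | pi v == s.+1) g v <= 0.
    by apply: sumr_le0 => v /eqP; apply: gle.
  have -> : (L0 <= s.+1)%N%:R = (L0 <= s)%N%:R + (s.+1 == L0)%:R :> R.
    by rewrite -natrD; congr (_%:R); lia.
  by rewrite /= in Ds *; lra.
(* As [l >= 1], [L0] has been passed here, so the last difference before the middle is at most
   -1. *)
have [|P1 D1] := main (2 * p + l)%N; first by lia.
move: D1; rewrite -[(2 * p + l).+1]addn1 potential_mid (_ : (L0 <= _)%N = true) /=; last by rewrite /L0; lia.
by lra.
Qed.

Let G (u : T) : R := \sum_v d u v * g v.

Lemma c_w0 : c w0 = 0.
Proof. by rewrite /c /d /d' !dpi0 subrr. Qed.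

(** The reflection exchanges the distances to the old and the new place of [w0], so by antisymmetry
    both halves of [c] contribute [G w0]. *)
Lemma G_w0 : G w0 = (\sum_u c u * g u) / 2.
Proof.
have E : \sum_u c u * g u = G w0 + \sum_u - (d' u w0 * g u).
  by rewrite -big_split /=; apply: eq_bigr => u _; rewrite /c /d (dpi_sym _ _ w0); ring.
rewrite E (_ : \sum_u - _ = G w0); first by field.
rewrite /G [RHS](reindex_inj (inv_inj flipK)) /=; apply: eq_bigr => u _.
rewrite g_flip; case: (boolP (K u)) => [Ku|/g0->]; last by rewrite !mulr0 !oppr0 ?mulr0.
by rewrite /d dpi_sym -/d dw0_flip // mulrN.
Qed.

Lemma c_out u : u != w0 -> (M <= pi u)%N -> c u = - l%:R.
Proof.
move=> uw Mu; rewrite /c dw0 // d'w0 // !dposE.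
have -> : podd R0 = podd L0 by rewrite /podd /R0 /L0; congr ((nat_of_bool _)%:R); lia.
rewrite !absd_ge; [|by rewrite /L0; move: Mu; rewrite /M; lia|by rewrite /R0; move: Mu; rewrite /M; lia].
have -> : R0%:R = L0%:R + 2 * l%:R :> R by rewrite -natrM -natrD; congr (_%:R); rewrite /R0 /L0; lia.
by field.
Qed.

(** Seen from [K], the vertex [u] is farther than the end [t] of [K] at position [M] by a constant,
    which [sum_g] kills. So [G u = G t], while [c u = c t], and [t] is the mirror image of [v1]. *)
Lemma G_out v1 u : pi v1 = 0%N -> u != w0 -> (M < pi u)%N -> c u + G u = - (r * g v1).
Proof.
move=> pv1 uw Mu.
have /sh.2[t pt] : posok p q l M by rewrite /posok /M; lia.
have tw : t != w0 by apply: contraTneq isT => E; move: pt; rewrite E pw0 /R0 /M; lia.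
have Kt : K t by rewrite /K tw pt leqnn.
have ft : flip t = v1 by apply: sh.1; have [_ ->] := flipP Kt; rewrite pt pv1 subnn.
have GE : G u = G t.
  rewrite -[RHS]addr0 -(mulr0 (d u t)) -[in RHS]sum_g mulr_sumr -big_split /=.
  apply: eq_bigr => v _; rewrite -mulrDl; case: (boolP (K v)) => [/andP[_ vM]|/g0->]; last by rewrite !mulr0.
  congr (_ * _).
  have uv : u != v by apply: contraTneq Mu => ->; rewrite -leqNgt.
  have ut : u != t by apply: contraTneq Mu => ->; rewrite -leqNgt pt.
  rewrite /d /dpi (negPf uv) (negPf ut).
  have oM : podd M = 0 by rewrite /podd (_ : odd M = false) // /M; lia.
  case: (eqVneq t v) => [<-|_]; first by rewrite add0r.
  rewrite !dposE pt oM !absd_ge //; [by field | exact: ltnW | exact: leq_trans (ltnW Mu)].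
have := gK Kt; rewrite -/(G t) => Gt.
by rewrite GE Gt -ft g_flip !c_out ?pt // ?(ltnW Mu) //; ring.
Qed.

Lemma qform_moved y : qform d' (enum T) y = qform d (enum T) y - 2 * y w0 * \sum_u c u * y u.
Proof.
have pe : perm_eq (enum T) (w0 :: rem w0 (enum T)) by apply: perm_to_rem; rewrite mem_enum.
rewrite !(perm_qform _ _ pe) !qform_cons; try exact: dpi0; try exact: dpi_sym.
have -> : \sum_u c u * y u = \sum_(u <- rem w0 (enum T)) (d w0 u * y u - d' w0 u * y u).
  have -> : \sum_u c u * y u = \sum_(u <- w0 :: rem w0 (enum T)) c u * y u.
    by rewrite -(perm_big _ pe) big_enum.
  rewrite big_cons c_w0 mul0r add0r; apply: eq_bigr => u _.
  by rewrite /c /d /d' dpi_sym (dpi_sym _ moved u); ring.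
rewrite sumrB (_ : qform d' _ y = qform d (rem w0 (enum T)) y); first by ring.
apply: eq_big_seq => u; rewrite mem_rem_uniq ?enum_uniq // inE => /andP[uw _].
apply: eq_big_seq => v; rewrite mem_rem_uniq ?enum_uniq // inE => /andP[vw _].
by rewrite /d' /d /dpi /moved (negPf uw) (negPf vw).
Qed.

Lemma moved_gain : exists y, r * \sum_u y u ^+ 2 < qform d' (enum T) y.
Proof.
have /sh.2[v1 pv1] : posok p q l 0 by rewrite /posok; lia.
have /sh.2[t pt] : posok p q l (2 * (p + q + l)) by rewrite /posok; lia.
have vw : v1 != w0 by apply: contraTneq isT => E; move: pv1; rewrite E pw0 /R0.
have tw : t != w0 by apply: contraTneq isT => E; move: pt; rewrite E pw0 /R0; lia.
have g1 : 0 < g v1.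
  have K1 : K v1 by rewrite /K vw pv1.
  have := potential0_gt0; rewrite -[in potential _]pv1 -potentialE // pmulr_rgt0 //.
  by apply: ltr_wpDr r_gt0; rewrite /podd ler0n.
pose X := \sum_(u | (u != w0) && (M < pi u)%N) x u.
have X0 : 0 < X.
  rewrite /X (bigD1 t) /=; last by rewrite tw pt /M; lia.
  by apply: ltr_wpDr => //; apply: sumr_ge0 => u _; apply: ltW.
pose w := x w0; pose C := \sum_u c u * g u.
have xG : \sum_u x u * G u = r * \sum_u x u * g u by apply: dsum_sym.
have gG : \sum_u g u * G u = r * (\sum_u g u * g u) - C.
  rewrite mulr_sumr -sumrB; apply: eq_bigr => u _.
  by case: (boolP (K u)) => [/gK|/g0 ->]; [rewrite /G => ->; ring | ring].
(* Adding [G - r g] is free when paired with the eigenvector [x], and makes the terms at vertices of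
   [K] vanish. *)
have cx : \sum_u c u * x u = w * (C / 2) - r * g v1 * X.
  have -> : \sum_u c u * x u = \sum_u (c u + G u - r * g u) * x u.
    have -> : \sum_u (c u + G u - r * g u) * x u =
        \sum_u c u * x u + (\sum_u x u * G u - r * \sum_u x u * g u).
      by rewrite mulr_sumr -sumrB -big_split /=; apply: eq_bigr => u _; ring.
    by rewrite xG subrr addr0.
  rewrite (bigD1 w0) //= c_w0 G_w0 g0 ?/K ?eqxx // -/C -/w.
  rewrite (bigID (fun u => M < pi u)%N) /= [X in _ + (_ + X)]big1; last first.
    move=> u /andP[uw]; rewrite -leqNgt => uM.
    by rewrite /G gK ?/K ?uw //; ring.
  rewrite (eq_bigr (fun u => - (r * g v1) * x u)); last first.
    move=> u /andP[uw uM].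
    have gu : g u = 0 by apply: g0; rewrite /K uw /= -ltnNge.
    by rewrite (G_out pv1 uw uM) gu mulr0 subr0.
  by rewrite -mulr_sumr -/X; ring.
pose y u := x u - w * g u.
exists y; rewrite qform_moved.
have yw : y w0 = w by rewrite /y g0 ?/K ?eqxx // mulr0 subr0.
have -> : qform d (enum T) y = r * (\sum_u y u ^+ 2) - w ^+ 2 * C.
  have -> : qform d (enum T) y = \sum_u y u * (r * x u - w * G u).
    rewrite /qform big_enum /=; apply: eq_bigr => u _; rewrite big_enum /=.
    rewrite -xev /G mulr_sumr -sumrB mulr_sumr; apply: eq_bigr => v _.
    by rewrite /y; ring.
  have -> : \sum_u y u * (r * x u - w * G u) = r * (\sum_u y u ^+ 2)
     - w * (\sum_u x u * G u - r * \sum_u x u * g u)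
     + w ^+ 2 * (\sum_u g u * G u - r * \sum_u g u * g u).
    rewrite !mulr_sumr -!sumrB !mulr_sumr -sumrB -big_split /=; apply: eq_bigr => u _.
    by rewrite /y; ring.
  by rewrite xG gG; ring.
have -> : \sum_u c u * y u = w * (C / 2) - r * g v1 * X - w * C.
  by rewrite -cx /C mulr_sumr -sumrB; apply: eq_bigr => u _; rewrite /y; ring.
(* The terms in [C] cancel: [-w^2 C], [-2w (wC / 2)] and [2w (wC)]. *)
rewrite yw -subr_gt0 (_ : _ - _ = 2 * w * r * g v1 * X); last by field.
by rewrite !mulr_gt0 // ?r_gt0 // xp.
Qed.

End Response.

Lemma balance_gain : exists y, r * \sum_u y u ^+ 2 < qform d' (enum T) y.
Proof. by have [g g0 gK] := response_exists; apply: moved_gain g0 gK. Qed.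

End Balance.

(** * The balanced chain is extremal, and the case of equality *)

Section Extremal.
Variable R : realType.

Lemma S_rel_connected p q l : connected_graph (S_rel p q l).
Proof.
by move=> u v; have [] := dist_shape (spos_shape p q l) (@spos_adj p q l) u v.
Qed.

Lemma dR_S_rel p q l u v : dR (S_rel p q l) R u v = dpi R (fun w : 'I_(2 * (p + q) + l + 1) => spos p q l w) u v.
Proof.
have [_ E] := dist_shape (spos_shape p q l) (@spos_adj p q l) u v.
rewrite /dR E /dpi; case: eqP => _ //; rewrite /dpos -/(dposn _ _).
set m := dposn _ _; have -> : m = (2 * m./2)%N by rewrite /m /dposn; lia.
by rewrite natrM mul2n doubleK; field.
Qed.

Lemma shape_bij (T T' : finType) p q l (pi : T -> nat) (pi' : T' -> nat) :
  shape p q l pi -> shape p q l pi' ->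
  exists2 f : T -> T', bijective f & forall u, pi' (f u) = pi u.
Proof.
have mk (T1 T2 : finType) (p1 : T1 -> nat) (p2 : T2 -> nat) :
    shape p q l p1 -> shape p q l p2 -> exists f : T1 -> T2, forall u, p2 (f u) = p1 u.
  move=> s1 s2; have ex u : exists v, p2 v == p1 u.
    have /s1.2/s2.2[v pv] : exists w, p1 w = p1 u by exists u.
    by exists v; apply/eqP.
  by exists (fun u => xchoose (ex u)) => u; apply/eqP/(xchooseP (ex u)).
move=> s1 s2; have [f fP] := mk _ _ _ _ s1 s2; have [g gP] := mk _ _ _ _ s2 s1.
exists f => //; exists g => u; [apply: s1.1 | apply: s2.1].
  by rewrite gP fP.
by rewrite fP gP.
Qed.

Lemma shape_rev (T : finType) p q l (pi : T -> nat) : shape p q l pi ->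
  exists2 pi' : T -> nat, shape q p l pi' & forall u v, dpi R pi' u v = dpi R pi u v.
Proof.
move=> sh; have le u : (pi u <= 2 * (p + q + l))%N.
  by have /sh.2/andP[] : exists v, pi v = pi u by exists u.
exists (fun u => 2 * (p + q + l) - pi u)%N.
  split=> [u v E|s]; first by apply: sh.1; have := le u; have := le v; lia.
  split=> [[u <-]|ok].
    have /sh.2 : exists v, pi v = pi u by exists u.
    by rewrite /posok; lia.
  have /sh.2[u pu] : posok p q l (2 * (p + q + l) - s) by move: ok; rewrite /posok; lia.
  by exists u; rewrite pu; move: ok; rewrite /posok; lia.
move=> u v; rewrite /dpi; case: eqP => // _; exact: dpos_mirror.
Qed.

Lemma eq_spectral_radius (T : finType) (d d' : T -> T -> R) r :
  (forall u v, d u v = d' u v) -> spectral_radius d r -> spectral_radius d' r.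
Proof.
move=> E [bd [x xp ev]]; split.
  by move=> y; have := bd y; rewrite !qform_enum; under eq_bigr do under eq_bigr do rewrite E.
by exists x => // u; rewrite -ev; apply: eq_bigr => v _; rewrite E.
Qed.

Lemma shape_radius (T : finType) p q l (pi : T -> nat) : shape p q l pi -> (0 < p + q)%N ->
  exists r, spectral_radius (dpi R pi) r.
Proof.
move=> sh pq; apply: spectral_radius_exists.
- exact: dpi_sym.
- exact: dpi0.
- by move=> u v; apply: dpi_gt0 sh.1.
have /sh.2[u pu] : posok p q l 0 by rewrite /posok; lia.
have /sh.2[v pv] : posok p q l 2 by rewrite /posok; lia.
have uv : u != v by apply: contraTneq isT => E; move: pv; rewrite -E pu.
rewrite -(cardC (pred1 u)) card1 ltnS; apply/card_gt0P; exists v.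
by rewrite !inE eq_sym.
Qed.

(** Induction on the imbalance [m]. For [l >= 1] moving a triangle raises the radius strictly, so
    equality then arises only from the balanced case. *)
Lemma shape_extremal m (T : finType) p q l (pi : T -> nat) r rS :
  ((p - q) + (q - p) <= m)%N -> (0 < p + q)%N ->
  shape p q l pi -> spectral_radius (dpi R pi) r ->
  let S := S_rel (p + q)./2 (uphalf (p + q)) l in
  spectral_radius (dR S R) rS ->
  r <= rS /\ (r = rS -> exists2 f, bijective f & forall u v, dR S R (f u) (f v) = dpi R pi u v).
Proof.
elim/ltn_ind: m p q pi r => m IH p q pi r.
wlog pq : p q pi r / (p <= q)%N.
  move=> H mle pq0 sh rad S radS.
  case: (leqP p q) => [|/ltnW] pq; first exact: (H p q pi).
  have [pi' sh' E] := shape_rev sh.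
  have rad' : spectral_radius (dpi R pi') r by apply: eq_spectral_radius rad => u v; rewrite E.
  have mle' : ((q - p) + (p - q) <= m)%N by rewrite addnC.
  have := H q p pi' r pq mle'; rewrite (addnC q p) => /(_ pq0 sh' rad' radS)[h1 h2].
  by split=> // /h2[f bf fE]; exists f => // u v; rewrite fE E.
move=> mle pq0 sh rad S radS.
have card0 : (0 < #|T|)%N.
  have /sh.2[u _] : posok p q l 0 by rewrite /posok; lia.
  by apply/card_gt0P; exists u.
case: (leqP q p.+1) => qp.
  have pE : p = (p + q)./2 by lia.
  have qE : q = uphalf (p + q) by rewrite uphalf_half; lia.
  have sh' : shape (p + q)./2 (uphalf (p + q)) l pi by rewrite -pE -qE.
  have [f bf fE] := shape_bij sh' (spos_shape _ _ l).
  have iso u v : dR S R (f u) (f v) = dpi R pi u v.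
    by rewrite dR_S_rel /dpi !fE (inj_eq (bij_inj bf)).
  by split; [exact: spectral_radius_le card0 bf iso rad radS | exists f].
have pq1 : (p.+1 + q.-1 = p + q)%N by lia.
have lt : ((p.+1 - q.-1) + (q.-1 - p.+1) < m)%N by lia.
(* Without a linking path, the place where the left run ends is only a matter of naming, and [pi]
   already has the better balanced shape. *)
case: (posnP l) => [l0|l1].
  have sh' : shape p.+1 q.-1 l pi.
    split=> [|s]; first exact: sh.1.
    by rewrite sh.2 /posok l0; split; lia.
  have := IH _ lt p.+1 q.-1 pi r; rewrite pq1; exact.
have /sh.2[w0 pw0] : posok p q l (2 * (p + l)).+1 by rewrite /posok; lia.
have [bd [x xp ev]] := rad.
have sh' := moved_shape sh l1 (_ : p + 2 <= q)%N pw0.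
have pq2 : (p + 2 <= q)%N by lia.
have [r' rad'] : exists r', spectral_radius (dpi R (moved p pi w0)) r'.
  by apply: (shape_radius (sh' pq2)); rewrite pq1.
have [y yP] := balance_gain sh l1 pq2 xp ev pw0.
have rr' : r < r'.
  have [bd' _] := rad'; have := lt_le_trans yP (bd' y).
  have : 0 <= \sum_u y u ^+ 2 by apply: sumr_ge0 => u _; apply: sqr_ge0.
  rewrite le_eqVlt => /orP[/eqP<-|s0]; first by rewrite !mulr0 ltxx.
  by rewrite ltr_pM2r.
have [] := IH _ lt p.+1 q.-1 (moved p pi w0) r'; rewrite ?pq1 //; first exact: sh'.
move=> le _; have rS' : r < rS by apply: lt_le_trans le.
by split; [exact: ltW | move=> E; rewrite E ltxx in rS'].
Qed.

(** The form at a sum of two unit vectors isolates one entry, as the diagonals vanish. *)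
Lemma qform_polar (T : finType) (d d' : T -> T -> R) :
  (forall u v, d u v = d v u) -> (forall u, d u u = 0) ->
  (forall u v, d' u v = d' v u) -> (forall u, d' u u = 0) ->
  (forall y, qform d (enum T) y = qform d' (enum T) y) -> forall u v, d u v = d' u v.
Proof.
move=> ds d0 ds' d0' E u v.
pose y1 := bump (fun _ : T => 0 : R) v 1.
have s (b : T -> T -> R) : \sum_(z <- enum T) b u z * y1 z = b u v.
  rewrite sum_bump ?enum_uniq ?mem_enum // big1 ?add0r ?mulr1 // => i _.
  by rewrite mulr0.
have := E (bump y1 u 1).
rewrite ![qform _ _ (bump y1 _ _)]qform_bump ?enum_uniq ?mem_enum // E !s => /addrI.
by rewrite mulr1; apply: mulfI; rewrite pnatr_eq0.
Qed.

End Extremal.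

Lemma dist_iso (T T' : finType) (e : rel T) (e' : rel T') (f : T -> T') :
  connected_graph e -> connected_graph e' -> bijective f ->
  (forall x y, e' (f x) (f y) = e x y) -> forall u v, dist e' (f u) (f v) = dist e u v.
Proof.
have le (T1 T2 : finType) (e1 : rel T1) (e2 : rel T2) (h : T1 -> T2) :
    connected_graph e1 -> connected_graph e2 -> (forall x y, e2 (h x) (h y) = e1 x y) ->
    forall u v, (dist e2 (h u) (h v) <= dist e1 u v)%N.
  move=> c1 c2 hE u v; have [s [es <- <-]] := dist_path c1 u v.
  rewrite -(size_map h) -last_map; apply: dist_le_size => //.
  by rewrite path_map (eq_path (e' := e1)).
move=> c c' [g fg gf] fE u v; apply/eqP; rewrite eqn_leq le //=.
rewrite -[X in (dist e X _ <= _)%N](fg u) -[X in (dist e _ X <= _)%N](fg v); apply: le => // x y.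
by rewrite -fE !gf.
Qed.

Theorem theorem1p3 (R : realType) (T : finType) (e : rel T) (n k : nat) :
  #|T| = n ->
  (1 <= k)%N -> (k <= (n - 1)./2)%N ->
  simple_graph e -> cactus e -> num_cycles_eq e k -> all_cycles_triangles e ->
  forall rhoG rhoS : R,
    largest_eig (dist_mx R e) rhoG ->
    largest_eig (dist_mx R (S_rel k./2 (uphalf k) (n - 2 * k - 1))) rhoS ->
    rhoG <= rhoS /\
    (rhoG = rhoS <-> graph_iso e (S_rel k./2 (uphalf k) (n - 2 * k - 1))).
Proof.
move=> Tn k1 kn simple cact [C [Ck CP]] cyc3 rhoG rhoS eigG eigS.
have conn := cact.1.
have T1 : (1 < #|T|)%N by lia.
have T0 := ltnW T1.
have radG := largest_eig_radius T1 simple conn eigG.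
set l := (n - 2 * k - 1)%N in eigS *.
have connS := @S_rel_connected k./2 (uphalf k) l.
have simpleS := S_rel_simple k./2 (uphalf k) l.
have radS : spectral_radius (dR (S_rel k./2 (uphalf k) l) R) rhoS.
  by apply: largest_eig_radius => //; rewrite card_ord; lia.
have [bdG [x xp evG]] := radG.
have [z [A [B [pe nt cmp]]]] := graph_below_chain simple cact cyc3 T0 xp.
have ntk : (ntri A + ntri B = k)%N.
  rewrite nt -Ck; apply/esym; apply: (card_all_cycles simple cyc3 CP) => u.
  by rewrite mem_enum.
have [z' [B' [p [l' [q [pB' pe' pqk cmp']]]]]] := chain_sorted z A B xp.
have pe2 : perm_eq (z' :: labels B') (enum T) := perm_trans pe' pe.
have pqk' : (p + q)%N = k by rewrite pqk ntk.
have size_lab (D : seq (option T * T)) : size (labels D) = (size (pat D) + ntri D)%N.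
  elim: D => [|[o v] D IH] //; rewrite lab_cons size_cat /= IH /ntri /=.
  by case: o => [y|] /=; lia.
(* Counting vertices: one for the base, one per block, one more per triangle. *)
have l'E : l' = l.
  have := perm_size pe2; rewrite /= size_lab -cardE Tn pB' /ntri pB' !size_cat !count_cat.
  by rewrite !size_nseq !count_nseq /= /l -pqk'; lia.
rewrite l'E in pB'.
have [pi sh piE] := chain_shape R pe2 pB'.
have pq0 : (0 < p + q)%N by rewrite pqk'.
have [r rad] := shape_radius R sh pq0.
have := @shape_extremal R _ T p q l pi r rhoS (leqnn _) pq0 sh rad.
rewrite pqk' => /(_ radS)[rS rSeq].
have [bd _] := rad.
have x0 := sum_sqr_gt0 T0 xp.
have QG := qform_eigen evG.
(* At the Perron vector [x] of [G] the form of [G] is [rhoG |x|^2], that of the chain at most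
   [r |x|^2]. *)
have [le eqQ] : rhoG <= r /\ (rhoG = r -> forall y, qform (dR e R) (enum T) y = qform (dpi R pi) (enum T) y).
  have bdx := bd x; rewrite piE in bdx.
  have step : qform (dR e R) (enum T) x < 2 * chain_form x z' [::] B' \/
      forall y, qform (dR e R) (enum T) y = qform (dpi R pi) (enum T) y.
    case: cmp => [lt|eq].
      left; apply: lt_le_trans lt _; rewrite ler_pM2l //.
      by case: cmp' => [/ltW //|->].
    case: cmp' => [lt|eq']; first by left; rewrite eq ltr_pM2l.
    by right=> y; rewrite eq eq' piE.
  case: step => [lt|eq].
    have lt' : rhoG < r.
      by rewrite -(ltr_pM2r x0) -QG; apply: lt_le_trans lt bdx.
    by split; [exact: ltW | move=> E; rewrite E ltxx in lt'].
  split=> //; rewrite -(ler_pM2r x0) -QG eq; exact: bd.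
split; first exact: le_trans le rS.
split=> [E|[f [bf fE]]].
  have rE : r = rhoS by apply/eqP; rewrite eq_le rS -E le.
  have [f bf fE] := rSeq rE.
  have dE u v : dR e R u v = dpi R pi u v.
    apply: qform_polar => //; first by move=> ? ?; rewrite /dR dist_sym //; case: simple.
    - by move=> ?; rewrite /dR dist0.
    - exact: dpi_sym.
    - exact: dpi0.
    - by apply: eqQ; rewrite E rE.
  exists f; split=> // u v; rewrite -(dist_eq1 connS) ?simpleS.2 //; last exact: simpleS.2.
  rewrite -(dist_eq1 conn); last exact: simple.2.
  by have /eqP := fE u v; rewrite -dE /dR eqr_nat => /eqP->.
have iso := dist_iso conn connS bf fE.
have isoR u v : dR (S_rel k./2 (uphalf k) l) R (f u) (f v) = dR e R u v by rewrite /dR iso.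
have [g fg gf] := bf.
apply/eqP; rewrite eq_le (spectral_radius_le T0 bf isoR radG radS) /=.
apply: (@spectral_radius_le _ _ _ g _ _ _ _ _ _ _ radS radG).
- by rewrite card_ord; lia.
- by exists f.
- by move=> u v; rewrite -isoR !gf.
Qed.
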